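(* The elements of $\mathcal{K}(S^2)$ are in bijective correspondence with the elements of $\mathcal{K}(\mathbb{R}^2)$ in spherical state.
   Context: Let $\Sigma=\mathbb{R}^2$ or $\Sigma=S^2=\mathbb{R}^2\cup\{\infty\}$. A knotoid diagram in $\Sigma$ is a generic immersion of $[0,1]$ in $\Sigma$ whose only singularities are transversal double points (crossings) endowed with over/under-crossing data. The images of $0$ and $1$ are the leg and the head (the endpoints); they are distinct from each other and from the crossings, and the diagram is oriented from the leg to the head. Diagrams in $\mathbb{R}^2$ are called planar, those in $S^2$ spherical. Planar equivalence: two planar knotoid diagrams are planar equivalent if they are related by a finite sequence of local isotopies of $\mathbb{R}^2$ (which include swinging an endpoint within the region in which it lies) and Reidemeister moves RI, RII, RIII away from the endpoints. An equivalence class is a planar knotoid, and $\mathcal{K}(\mathbb{R}^2)$ is the set of planar knotoids. Spherical equivalence: two spherical knotoid diagrams are spherical equivalent if they are related by a finite sequence of local isotopies of $S^2$, moves RI, RII, RIII away from the endpoints, and spherical moves (a spherical move is a global isotopy move on $S^2$ in which an arc is pushed around the back of the sphere by a finite sequence of local isotopies of the sphere, i.e. the arc crosses the point $\infty$). An equivalence class is a spherical knotoid, and $\mathcal{K}(S^2)$ is the set of spherical knotoids. By general position, knotoid diagrams in $S^2$ are assumed to miss $\infty$; $s:S^2\setminus\{\infty\}\to\mathbb{R}^2$ denotes the stereographic projection. For a diagram $K$, $K_0$ denotes the 4-valent graph obtained from $K$ by forgetting the over/under data at the crossings. A diagram in $S^2$ is normal if its leg and the point $\infty$ lie in the same region (component)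 of $S^2\setminus K_0$. The image under $s$ of a normal diagram is a planar diagram whose leg lies in the unbounded region of $\mathbb{R}^2\setminus K_0$ (where $K_0$ is the graph of the planar diagram); such a planar diagram is said to be in spherical state. An element of $\mathcal{K}(\mathbb{R}^2)$ is in spherical state if it is represented by a planar knotoid diagram in spherical state. *)

(* Defs.v *)
From HB Require Import structures.
From Stdlib Require Export Relations.
From mathcomp Require Export all_boot all_order all_algebra.
From mathcomp Require Export all_classical all_reals all_analysis.

Set Implicit Arguments.
Unset Strict Implicit.
Unset Printing Implicit Defensive.

Export Order.TTheory GRing.Theory Num.Theory.
Export numFieldNormedType.Exports.

Local Open Scope classical_set_scope.
Local Open Scope ring_scope.

(* R^2 is the whole of 'rV[R]_2, and S^2 is the unit sphere of 'rV[R]_3.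
   Everything that does not depend on which surface is meant is stated for a
   subset Sigma of a normed space V. *)

Definition sqnorm (R : realType) (n : nat) (x : 'rV[R]_n) : R :=
  \sum_(i < n) x ord0 i ^+ 2.

Definition plane (R : realType) : set 'rV[R]_2 := setT.

Definition sphere (R : realType) : set 'rV[R]_3 := [set p | sqnorm p = 1].

(* The north pole (0, 0, 1). *)
Definition infty (R : realType) : 'rV[R]_3 := delta_mx ord0 ord_max.

(* (x, y, z) |-> (x / (1 - z), y / (1 - z)) *)
Definition stereo (R : realType) (p : 'rV[R]_3) : 'rV[R]_2 :=
  \row_(i < 2) (p ord0 (widen_ord (leqnSn 2) i) / (1 - p ord0 ord_max)).

(* [curve] matters only on [0, 1], and [over] only at pairs of parameters of
   a crossing; [over u v] says that the strand at u passes over the one at v.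
   Values elsewhere are junk that no predicate below looks at, except that the
   curve has to be C^1 on a neighbourhood of [0, 1], so that derivatives make
   sense at the endpoints (for S^2 the extension may leave the sphere). *)
Record diagram (R : realType) (V : normedModType R) := Diagram {
  curve : R -> V;
  over : R -> R -> bool
}.

Section Diagrams.
Variables (R : realType) (V : normedModType R).
Implicit Types (D : diagram V) (Sigma : set V) (t u v w p q : R).

Definition leg D : V := curve D 0.
Definition head D : V := curve D 1.

(* The underlying set of the 4-valent graph K_0. *)
Definition graph D : set V := curve D @` `[0, 1].

Definition crossing D (u v : R) : Prop :=
  [/\ 0 <= u <= 1, 0 <= v <= 1, u != v & curve D u = curve D v].

Definition lin_indep (x y : V) : Prop :=
  forall a b : R, a *: x + b *: y = 0 -> a = 0 /\ b = 0.

(* Finiteness of the set of crossings follows from transversality and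
   compactness of [0, 1]. *)
Record knotoid_diagram Sigma D : Prop := KnotoidDiagram {
  diagram_in : forall u, 0 <= u <= 1 -> Sigma (curve D u);
  diagram_C1 : forall u, 0 <= u <= 1 ->
    (\forall v \near u, derivable (curve D) v 1) /\
    {for u, continuous (derive1 (curve D))};
  diagram_immersion : forall u, 0 <= u <= 1 -> derive1 (curve D) u != 0;
  diagram_double : forall u v w,
    crossing D u v -> crossing D u w -> v = w;
  diagram_transversal : forall u v, crossing D u v ->
    lin_indep (derive1 (curve D) u) (derive1 (curve D) v);
  diagram_endpoints : leg D <> head D;
  diagram_leg : forall u, ~ crossing D 0 u;
  diagram_head : forall u, ~ crossing D 1 u;
  diagram_over : forall u v, crossing D u v -> over D u v = ~~ over D v u
}.

(* An isotopy of Sigma: a level-preserving homeomorphism of [0, 1] x Sigma that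
   starts at the identity. *)
Definition isotopy Sigma (h : R -> V -> V) : Prop :=
  (forall x, Sigma x -> h 0 x = x) /\
  exists g : R -> V -> V,
    [/\ forall t x, 0 <= t <= 1 -> Sigma x -> Sigma (h t x) /\ g t (h t x) = x,
        forall t x, 0 <= t <= 1 -> Sigma x -> Sigma (g t x) /\ h t (g t x) = x,
        {within `[0, 1] `*` Sigma, continuous (fun z : R * V => h z.1 z.2)} &
        {within `[0, 1] `*` Sigma, continuous (fun z : R * V => g z.1 z.2)}].

Definition carries (h : R -> V -> V) D D' : Prop :=
  (forall u, 0 <= u <= 1 -> curve D' u = h 1 (curve D u)) /\
  (forall u v, crossing D u v -> over D' u v = over D u v).

Definition closed_disc : set 'rV[R]_2 := [set x | sqnorm x <= 1].
Definition open_disc : set 'rV[R]_2 := [set x | sqnorm x < 1].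

Definition embedded_disc Sigma (phi : 'rV[R]_2 -> V) : Prop :=
  [/\ forall x, closed_disc x -> Sigma (phi x),
      {within closed_disc, continuous phi} &
      {in closed_disc &, injective phi}].

Definition inside n (a b : 'I_n -> R) (u : R) : Prop :=
  exists i, a i <= u <= b i.

(* The part of D in the disc consists of the n proper arcs parametrized by the
   intervals [a i, b i]. *)
Definition tangle n (a b : 'I_n -> R) (phi : 'rV[R]_2 -> V) D : Prop :=
  forall u, 0 <= u <= 1 ->
    ((phi @` closed_disc) (curve D u) <-> inside a b u) /\
    ((phi @` open_disc) (curve D u) <-> exists i, a i < u < b i).

(* D and D' differ only inside a disc of Sigma, which contains no endpoint and
   which both meet in n disjointly parametrized arcs with common ends. *)
Definition local_change Sigma n (a b : 'I_n -> R) D D' : Prop :=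
  [/\ forall i, [&& 0 < a i, a i < b i & b i < 1],
      forall i j, i != j -> b i < a j \/ b j < a i,
      exists phi, [/\ embedded_disc Sigma phi, tangle a b phi D &
                      tangle a b phi D'],
      forall u, 0 <= u <= 1 -> (forall i, ~ (a i < u < b i)) ->
        curve D' u = curve D u &
      forall u v, crossing D u v -> ~ inside a b u -> over D' u v = over D u v].

Definition no_crossing_inside n (a b : 'I_n -> R) D : Prop :=
  forall u v, inside a b u -> ~ crossing D u v.

(* The pictures of the moves are given by their crossings, which determine them
   up to a homeomorphism of the disc.  All choices of orientation of the
   strands and of crossing signs are covered. *)

(* RI: a simple arc is replaced by an arc with one self-crossing. *)
Definition RI Sigma D D' : Prop :=
  exists a b : 'I_1 -> R,
  [/\ local_change Sigma a b D D',
      no_crossing_inside a b D &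
      exists p q, [/\ inside a b p, crossing D' p q &
        forall u v, inside a b u -> crossing D' u v ->
          (u, v) \in [:: (p, q); (q, p)]]].

(* RII: two disjoint simple arcs are replaced by two simple arcs which meet
   twice, arc 0 passing over arc 1 both times. *)
Definition RII Sigma D D' : Prop :=
  exists a b : 'I_2 -> R,
  [/\ local_change Sigma a b D D',
      no_crossing_inside a b D &
      exists p q p' q',
      [/\ [/\ a 0 < p < b 0, a 0 < q < b 0, a 1 < p' < b 1, a 1 < q' < b 1 &
              p != q],
          crossing D' p p' /\ over D' p p',
          crossing D' q q' /\ over D' q q' &
          forall u v, inside a b u -> crossing D' u v ->
            (u, v) \in [:: (p, p'); (p', p); (q, q'); (q', q)]]].

(* Three simple arcs, any two of which meet once, arc i at parameter c i j and
   arc j at parameter c j i; for i < j arc i passes over arc j. *)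
Definition triangle (a b : 'I_3 -> R) (c : 'I_3 -> 'I_3 -> R) D : Prop :=
  [/\ forall i j, i != j -> a i < c i j < b i /\ crossing D (c i j) (c j i),
      forall i j : 'I_3, (i < j)%N -> over D (c i j) (c j i) &
      forall u v, inside a b u -> crossing D u v ->
        exists i j, [/\ i != j, u = c i j & v = c j i]].

(* RIII: moving a strand across the crossing of the two others reverses the
   order of the two crossings on each of the three strands. *)
Definition RIII Sigma D D' : Prop :=
  exists a b : 'I_3 -> R, exists c c' : 'I_3 -> 'I_3 -> R,
  [/\ local_change Sigma a b D D',
      triangle a b c D, triangle a b c' D' &
      forall i j k : 'I_3, i != j -> i != k -> j != k ->
        (c i j < c i k <-> c' i k < c' i j)].

Definition reidemeister Sigma D D' : Prop :=
  [\/ RI Sigma D D', RII Sigma D D' | RIII Sigma D D'].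

End Diagrams.

Section Knotoids.
Variable R : realType.
Implicit Types t u : R.

Definition planar_diagram : set (diagram 'rV[R]_2) :=
  [set D | knotoid_diagram (@plane R) D].

(* Finite sequences of local isotopies have the same effect on diagrams as
   isotopies of the whole surface, so the latter are used as generators. *)
Definition planar_isotopy (D D' : diagram 'rV[R]_2) : Prop :=
  exists h, isotopy (@plane R) h /\ carries h D D'.

Definition planar_move (D D' : diagram 'rV[R]_2) : Prop :=
  [/\ planar_diagram D, planar_diagram D' &
      planar_isotopy D D' \/ reidemeister (@plane R) D D'].

Definition planar_equiv := clos_refl_sym_trans _ planar_move.

Definition planar_class (D : diagram 'rV[R]_2) : set (diagram 'rV[R]_2) :=
  [set D' | planar_equiv D D'].

(* K(R^2) *)
Definition planar_knotoids : set (set (diagram 'rV[R]_2)) :=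
  planar_class @` planar_diagram.

Definition spherical_diagram : set (diagram 'rV[R]_3) :=
  [set E | knotoid_diagram (@sphere R) E /\ ~ graph E (infty R)].

(* An isotopy of S^2 during which the diagram stays off infty. *)
Definition spherical_isotopy (E E' : diagram 'rV[R]_3) : Prop :=
  exists h, [/\ isotopy (@sphere R) h, carries h E E' &
    forall t u, 0 <= t <= 1 -> 0 <= u <= 1 -> h t (curve E u) <> infty R].

(* An isotopy of S^2 during which the diagram crosses infty. *)
Definition spherical_move (E E' : diagram 'rV[R]_3) : Prop :=
  exists h, [/\ isotopy (@sphere R) h, carries h E E' &
    exists t u, [/\ 0 <= t <= 1, 0 <= u <= 1 & h t (curve E u) = infty R]].

Definition spherical_step (E E' : diagram 'rV[R]_3) : Prop :=
  [/\ spherical_diagram E, spherical_diagram E' &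
      [\/ spherical_isotopy E E', reidemeister (@sphere R) E E' |
          spherical_move E E']].

Definition spherical_equiv := clos_refl_sym_trans _ spherical_step.

Definition spherical_class (E : diagram 'rV[R]_3) : set (diagram 'rV[R]_3) :=
  [set E' | spherical_equiv E E'].

(* K(S^2) *)
Definition spherical_knotoids : set (set (diagram 'rV[R]_3)) :=
  spherical_class @` spherical_diagram.

(* The leg is a point of the graph, so that it lies in a region means that it
   lies in the closure of that component of the complement of the graph. *)

Definition normal (E : diagram 'rV[R]_3) : Prop :=
  closure (connected_component (@sphere R `\` graph E) (infty R)) (leg E).

Definition in_spherical_state (D : diagram 'rV[R]_2) : Prop :=
  exists x, let region := connected_component (@plane R `\` graph D) x in
    [/\ (@plane R `\` graph D) x, ~ bounded_set region &
        closure region (leg D)].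

Definition knotoids_in_spherical_state : set (set (diagram 'rV[R]_2)) :=
  [set k | planar_knotoids k /\
    exists D, [/\ planar_diagram D, k D & in_spherical_state D]].

Definition stereo_diagram (E : diagram 'rV[R]_3) : diagram 'rV[R]_2 :=
  Diagram (fun u => stereo (curve E u)) (over E).

End Knotoids.

(* Main.v *)
Require Import Defs.
From mathcomp Require Import ring lra.

(** A diagram E on the sphere has a point p of the complement of its graph in the
    region at its leg; projecting stereographically from p gives a planar diagram
    in spherical state.  The idea is that the planar knotoid obtained depends
    only on the spherical knotoid of E.  For a normal diagram p can be taken to
    be the north pole, and the correspondence becomes E |-> stereo_diagram E.

    The region at the leg is well defined and survives all moves.  Near the leg
    a C^1 curve is an arc that lies in a cone and meets each line across the
    cone at most once, so that its complement is locally in one piece there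
    ([leg_connected], [leg_approach]).  The disc of a Reidemeister move does not
    meet the leg; hence a point close enough to the leg serves before and after
    the move, lies off the disc, and projecting from it turns the move into a
    planar one ([reidemeister_planar]).

    Isotopies of the sphere may move the point of projection, and may move the
    diagram across the north pole; spherical moves are not treated apart.  Let
    an isotopy h carry E to E', and let p and p' be points of the leg regions of
    E and E'.  It takes p to a point of the leg region of E', which an isotopy
    fixing the graph of E' pushes to p' ([push_component]): the reachable points
    form an open and closed subset of the region, since close points are
    exchanged by a twist of a small cap ([push_near]).  Composing, p moves along
    a path to p'.  This path lifts to a path of rotations ([rotation_lift]);
    correcting by them gives an isotopy that keeps the point of projection fixed,
    that is, an isotopy of the plane.  It ends at the right diagram up to a
    rotation about the axis of projection, which is joined to the identity
    ([rotation_axis]).  This is [isotopy_planar], and it also covers two choices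
    of p for one diagram.

    Conversely, an isotopy of the plane extends to the sphere by fixing the north
    pole, continuity there being a matter of compactness of [0, 1]
    ([homeo_family_extend]), so that planar equivalence of projections implies
    spherical equivalence ([lift_equiv], [lift_stereo]).  This gives
    injectivity.  For surjectivity, lifting exchanges diagrams in spherical state
    and normal ones ([state_normal], [normal_state]), and every diagram becomes
    normal after a rotation of the sphere ([normal_ex]). *)

Set Implicit Arguments.
Unset Strict Implicit.
Unset Printing Implicit Defensive.

Local Open Scope classical_set_scope.
Local Open Scope ring_scope.

(** * Connected sets and limits *)

Section Topology.

(** The induction principle of connected sets: it is how a property known at one
    point of a region is spread over the whole region. *)
Lemma connected_locally_constant (T : topologicalType) (C P : set T) (x : T) :
  connected C -> C x -> P x ->
  (forall y, C y -> P y -> \forall z \near y, C z -> P z) ->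
  (forall y, C y -> ~ P y -> \forall z \near y, C z -> ~ P z) ->
  forall y, C y -> P y.
Proof.
move=> cC Cx Px oP oN.
suff e : C `&` P = C by move=> y; rewrite -e => -[].
apply: cC.
- by exists x.
- exists (interior [set y | C y -> P y]); first exact: open_interior.
  rewrite eqEsubset; split => y [Cy Hy]; split => //; first exact: oP.
  by have := interior_subset Hy; apply.
- exists (~` interior [set y | C y -> ~ P y]).
    by apply: open_closedC; exact: open_interior.
  rewrite eqEsubset; split => y [Cy Hy]; split => //.
    by move=> /interior_subset /(_ Cy); apply.
  by apply: contrapT => nP; apply: Hy; exact: oN.
Qed.

(** Used to attach the north pole to the lift of an unbounded planar region. *)
Lemma connected_add_limit (T : topologicalType) (A : set T) (y : T) :
  connected A -> closure A y -> connected (A `|` [set y]).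
Proof.
move=> cA Ay; apply/connectedP => E [E0 EU sE].
have AE : A `<=` E false `|` E true by rewrite -EU => x; left.
have [b Ab] : exists b, A `<=` E b.
  by have [h|h] := connected_subset sE AE cA; [exists false | exists true].
have dis : closure (E b) `&` E (~~ b) = set0.
  by case: sE => s1 s2; case: (b) => /=; rewrite // setIC.
have [z Ez] := E0 (~~ b).
have zU : (A `|` [set y]) z by rewrite EU; case: (b) Ez => /=; [left | right].
suff : (closure (E b) `&` E (~~ b)) z by rewrite dis.
split => //; case: zU => [/Ab /subset_closure //|->].
exact: closureS Ab _ Ay.
Qed.

Lemma closure_image (T U : topologicalType) (S A : set T) (B : set U) (f : T -> U) x :
  S x -> A `<=` S -> {within S, continuous f} -> (forall a, A a -> B (f a)) ->
  closure A x -> closure B (f x).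
Proof.
move=> Sx AS /subspace_continuousP fc AB Ax W /(fc x Sx) nW.
have [a [Aa]] := Ax _ nW; move=> /(_ (AS _ Aa)) Wa.
by exists (f a); split => //; exact: AB.
Qed.

Lemma component_image (T U : topologicalType) (S A : set T) (B : set U) (f : T -> U) x y :
  A `<=` S -> {within S, continuous f} -> (forall a, A a -> B (f a)) ->
  connected_component A x y -> connected_component B (f x) (f y).
Proof.
move=> AS fc AB [C [Cx CA cC] Cy]; exists (f @` C); last by exists y.
split; first by exists x.
  by move=> _ [a Ca <-]; apply: AB; exact: CA.
apply: connected_continuous_connected => //.
by apply: continuous_subspaceW fc => a /CA /AS.
Qed.

Lemma within_comp (T U W : topologicalType) (A : set T) (B : set U)
    (f : T -> U) (g : U -> W) x :
  (forall y, A y -> B (f y)) ->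
  f @ within A (nbhs x) --> f x -> g @ within B (nbhs (f x)) --> g (f x) ->
  (g \o f) @ within A (nbhs x) --> g (f x).
Proof.
move=> AB fx gx C /gx; rewrite /nbhs/= /within/= => gC.
have := fx _ gC; rewrite /nbhs/= /within/=.
apply: filterS => y h Ay; exact: h Ay (AB _ Ay).
Qed.

Lemma cvg_within_fst (T U : topologicalType) (A : set (T * U)) (z : T * U) :
  (fun y : T * U => y.1) @ within A (nbhs z) --> z.1.
Proof.
by apply: (cvg_trans (cvg_app _ (cvg_within _))); case: z => t u; exact: cvg_fst.
Qed.

Lemma cvg_within_snd (T U : topologicalType) (A : set (T * U)) (z : T * U) :
  (fun y : T * U => y.2) @ within A (nbhs z) --> z.2.
Proof.
by apply: (cvg_trans (cvg_app _ (cvg_within _))); case: z => t u; exact: cvg_snd.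
Qed.

End Topology.

(** * Coordinates and the Euclidean norm *)

Section Entries.
Context {R : realType}.

Lemma cvg_entries (T : Type) (F : set_system T) {FF : Filter F} m n
    (f : T -> 'M[R]_(m, n)) (M : 'M[R]_(m, n)) :
  (forall i j, (fun t => f t i j) @ F --> M i j) -> f @ F --> M.
Proof.
move=> fM A [P PM PA]; rewrite /nbhs/=.
apply: (@filterS _ F FF [set t | forall i j, P i j (f t i j)]).
  by move=> t /= Pt; apply: PA.
apply: filter_forall => i; apply: filter_forall => j.
exact: fM (PM i j).
Qed.

Lemma cvg_entry (T : Type) (F : set_system T) {FF : Filter F} m n
    (f : T -> 'M[R]_(m, n)) (M : 'M[R]_(m, n)) i j :
  f @ F --> M -> (fun t => f t i j) @ F --> M i j.
Proof.
move=> fM.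
apply: (@continuous_cvg _ _ _ _ _ f (fun N : 'M[R]_(m, n) => N i j) _ _ fM).
exact: coord_continuous.
Qed.

Lemma cvg_sum_seq (T : Type) (F : set_system T) {FF : Filter F} (I : Type)
    (s : seq I) (f : I -> T -> R) (a : I -> R) :
  (forall i, f i @ F --> a i) ->
  (fun t => \sum_(i <- s) f i t) @ F --> \sum_(i <- s) a i.
Proof.
move=> fa; elim: s => [|k s IH].
  rewrite big_nil (_ : (fun t => _) = cst 0); first exact: cvg_cst.
  by apply/funext => t; rewrite big_nil.
rewrite big_cons (_ : (fun t => _) = (fun t => f k t + \sum_(i <- s) f i t)).
  exact: cvgD.
by apply/funext => t; rewrite big_cons.
Qed.

Lemma cvg_mulmx (T : Type) (F : set_system T) {FF : Filter F} m n p
    (f : T -> 'M[R]_(m, n)) (g : T -> 'M[R]_(n, p)) (M : 'M[R]_(m, n)) (N : 'M[R]_(n, p)) :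
  f @ F --> M -> g @ F --> N -> (fun t => f t *m g t) @ F --> M *m N.
Proof.
move=> fM gN; apply: cvg_entries => i j; rewrite mxE.
under eq_fun do rewrite mxE.
by apply: cvg_sum_seq => k; apply: cvgM; apply: cvg_entry.
Qed.

Lemma continuous_mulmxr m n p (M : 'M[R]_(n, p)) :
  continuous (fun x : 'M[R]_(m, n) => x *m M).
Proof.
move=> x; apply: (@cvg_mulmx _ (nbhs x) _ _ _ _ id (fun=> M)).
  exact: cvg_id.
exact: cvg_cst.
Qed.

Lemma cvg_trmx (T : Type) (F : set_system T) {FF : Filter F} m n
    (f : T -> 'M[R]_(m, n)) (M : 'M[R]_(m, n)) :
  f @ F --> M -> (fun t => (f t)^T) @ F --> M^T.
Proof.
move=> fM; apply: cvg_entries => i j; rewrite mxE.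
under eq_fun do rewrite mxE.
exact: cvg_entry.
Qed.

End Entries.

Section SquareNorm.
Context {R : realType}.

Lemma sqnorm_ge0 n (x : 'rV[R]_n) : 0 <= sqnorm x.
Proof. by apply: sumr_ge0 => i _; apply: sqr_ge0. Qed.

Lemma sqnorm_mx n (x : 'rV[R]_n) : sqnorm x = (x *m x^T) ord0 ord0.
Proof. by rewrite /sqnorm mxE; apply: eq_bigr => i _; rewrite mxE expr2. Qed.

Lemma sqnorm_eq0 n (x : 'rV[R]_n) : (sqnorm x == 0) = (x == 0).
Proof.
apply/idP/idP => [|/eqP ->]; last first.
  by rewrite /sqnorm big1// => i _; rewrite mxE expr0n.
rewrite /sqnorm psumr_eq0 => [/allP h|i _]; last exact: sqr_ge0.
apply/eqP/rowP => i; rewrite mxE; apply/eqP; rewrite -sqrf_eq0.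
by apply: (implyP (h i _)); rewrite // mem_index_enum.
Qed.

Lemma cvg_sqnorm (T : Type) (F : set_system T) {FF : Filter F} n
    (f : T -> 'rV[R]_n) (x : 'rV[R]_n) :
  f @ F --> x -> (fun t => sqnorm (f t)) @ F --> sqnorm x.
Proof.
move=> fx; rewrite sqnorm_mx (_ : (fun t => _) =
  (fun t => (f t *m (f t)^T) ord0 ord0)); last first.
  by apply/funext => t; rewrite sqnorm_mx.
by apply: cvg_entry; apply: cvg_mulmx => //; apply: cvg_trmx.
Qed.

Lemma continuous_sqnorm n : continuous (@sqnorm R n).
Proof. by move=> x; apply: (@cvg_sqnorm _ (nbhs x) _ _ id x); exact: cvg_id. Qed.

(** The norm of row vectors is the sup norm, at most the Euclidean one. *)
Lemma norm_lt_sqnorm n (x : 'rV[R]_n) (e : R) :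
  0 < e -> sqnorm x < e ^+ 2 -> `|x| < e.
Proof.
move=> e0 xe; rewrite [`|_|]mx_normrE; apply: bigmax_lt => // -[i j] _ /=.
rewrite (ord1 i) -(ltr_pXn2r (n := 2)) ?nnegrE// ?(ltW e0)//.
rewrite real_normK ?num_real//; apply: le_lt_trans xe.
rewrite /sqnorm (bigD1 j)//= lerDl.
by apply: sumr_ge0 => k _; exact: sqr_ge0.
Qed.

Lemma compact_sqnorm_le n (M : R) : compact [set w : 'rV[R]_n | sqnorm w <= M].
Proof.
apply: bounded_closed_compact.
  exists (1 + `|M|); split; first exact: num_real.
  have hM := ler_norm M; have hM0 := normr_ge0 M.
  move=> K MK x /= xM; apply/ltW/norm_lt_sqnorm; first by lra.
  by apply: le_lt_trans xM _; nra.
rewrite (_ : mkset _ = @sqnorm R n @^-1` [set r | r <= M])//.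
apply: preimage_closed; last exact: closed_le.
by move=> x _; exact: continuous_sqnorm.
Qed.

Lemma nbhs_sqnorm n (q : 'rV[R]_n) (U : set 'rV[R]_n) : nbhs q U ->
  exists2 e : R, 0 < e & forall x, sqnorm (x - q) < e -> U x.
Proof.
move=> /nbhs_ballP[r /= r0 hr]; exists (r ^+ 2); first by rewrite exprn_gt0.
move=> x xr; apply: hr; rewrite -ball_normE /= distrC; exact: norm_lt_sqnorm.
Qed.

Lemma near_sqnorm n (q : 'rV[R]_n) (e : R) : 0 < e ->
  \forall x \near q, sqnorm (x - q) < e.
Proof.
move=> e0.
have c : (fun x => sqnorm (x - q)) @ nbhs q --> sqnorm (q - q).
  by apply: cvg_sqnorm; apply: cvgB; [exact: cvg_id | exact: cvg_cst].
have s0 : sqnorm (q - q) < e.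
  by rewrite subrr /sqnorm big1// => i _; rewrite mxE expr0n.
exact: (cvgr_lt _ c e s0).
Qed.

End SquareNorm.

Section Coordinates.
Context {R : realType}.
Implicit Types (p q : 'rV[R]_3) (w : 'rV[R]_2).

Definition px p := p ord0 ord0.
Definition py p := p ord0 (lift ord0 ord0).
Definition pz p := p ord0 ord_max.
Definition wx w := w ord0 ord0.
Definition wy w := w ord0 ord_max.

Definition vec3 (a b c : R) : 'rV[R]_3 :=
  \row_(i < 3) (if i == 0 :> nat then a else if i == 1 :> nat then b else c).
Definition vec2 (a b : R) : 'rV[R]_2 :=
  \row_(i < 2) (if i == 0 :> nat then a else b).

Lemma px_vec3 a b c : px (vec3 a b c) = a. Proof. by rewrite /px mxE. Qed.
Lemma py_vec3 a b c : py (vec3 a b c) = b. Proof. by rewrite /py mxE. Qed.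
Lemma pz_vec3 a b c : pz (vec3 a b c) = c. Proof. by rewrite /pz mxE. Qed.
Lemma wx_vec2 a b : wx (vec2 a b) = a. Proof. by rewrite /wx mxE. Qed.
Lemma wy_vec2 a b : wy (vec2 a b) = b. Proof. by rewrite /wy mxE. Qed.
Definition vecE := (px_vec3, py_vec3, pz_vec3, wx_vec2, wy_vec2).

Lemma ord3_ind (P : 'I_3 -> Prop) :
  P ord0 -> P (lift ord0 ord0) -> P ord_max -> forall i, P i.
Proof.
move=> P0 P1 P2 [[|[|[|//]]] h].
- by rewrite (_ : Ordinal h = ord0) //; apply: val_inj.
- by rewrite (_ : Ordinal h = lift ord0 ord0) //; apply: val_inj.
- by rewrite (_ : Ordinal h = ord_max) //; apply: val_inj.
Qed.

Lemma ord2_ind (P : 'I_2 -> Prop) : P ord0 -> P ord_max -> forall i, P i.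
Proof.
move=> P0 P1 [[|[|//]] h].
- by rewrite (_ : Ordinal h = ord0) //; apply: val_inj.
- by rewrite (_ : Ordinal h = ord_max) //; apply: val_inj.
Qed.

Lemma eq_vec3 p q : px p = px q -> py p = py q -> pz p = pz q -> p = q.
Proof.
by move=> h0 h1 h2; apply/rowP; apply: ord3_ind.
Qed.

Lemma eq_vec2 w v : wx w = wx v -> wy w = wy v -> w = v.
Proof. by move=> h0 h1; apply/rowP; apply: ord2_ind. Qed.

Lemma sqnorm3 p : sqnorm p = px p ^+ 2 + py p ^+ 2 + pz p ^+ 2.
Proof.
rewrite /sqnorm !big_ord_recl big_ord0 addr0 addrA; congr (_ + p _ _ ^+ 2).
exact: val_inj.
Qed.

Lemma sqnorm2 w : sqnorm w = wx w ^+ 2 + wy w ^+ 2.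
Proof.
rewrite /sqnorm !big_ord_recl big_ord0 addr0; congr (_ + w _ _ ^+ 2).
exact: val_inj.
Qed.

Lemma pxD p q : px (p + q) = px p + px q. Proof. by rewrite /px mxE. Qed.
Lemma pyD p q : py (p + q) = py p + py q. Proof. by rewrite /py mxE. Qed.
Lemma pzD p q : pz (p + q) = pz p + pz q. Proof. by rewrite /pz mxE. Qed.
Lemma pxN p : px (- p) = - px p. Proof. by rewrite /px mxE. Qed.
Lemma pyN p : py (- p) = - py p. Proof. by rewrite /py mxE. Qed.
Lemma pzN p : pz (- p) = - pz p. Proof. by rewrite /pz mxE. Qed.
Lemma pxZ a p : px (a *: p) = a * px p. Proof. by rewrite /px mxE. Qed.
Lemma pyZ a p : py (a *: p) = a * py p. Proof. by rewrite /py mxE. Qed.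
Lemma pzZ a p : pz (a *: p) = a * pz p. Proof. by rewrite /pz mxE. Qed.
Lemma px0 : px 0 = 0. Proof. by rewrite /px mxE. Qed.
Lemma py0 : py 0 = 0. Proof. by rewrite /py mxE. Qed.
Lemma pz0 : pz 0 = 0. Proof. by rewrite /pz mxE. Qed.
Lemma wxD w v : wx (w + v) = wx w + wx v. Proof. by rewrite /wx mxE. Qed.
Lemma wyD w v : wy (w + v) = wy w + wy v. Proof. by rewrite /wy mxE. Qed.
Lemma wxN w : wx (- w) = - wx w. Proof. by rewrite /wx mxE. Qed.
Lemma wyN w : wy (- w) = - wy w. Proof. by rewrite /wy mxE. Qed.
Lemma wxZ a w : wx (a *: w) = a * wx w. Proof. by rewrite /wx mxE. Qed.
Lemma wyZ a w : wy (a *: w) = a * wy w. Proof. by rewrite /wy mxE. Qed.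
Lemma wx0 : wx 0 = 0. Proof. by rewrite /wx mxE. Qed.
Lemma wy0 : wy 0 = 0. Proof. by rewrite /wy mxE. Qed.
Definition coordE := (pxD, pyD, pzD, pxN, pyN, pzN, pxZ, pyZ, pzZ, px0, py0, pz0,
  wxD, wyD, wxN, wyN, wxZ, wyZ, wx0, wy0).

Lemma px_infty : px (infty R) = 0. Proof. by rewrite /px mxE. Qed.
Lemma py_infty : py (infty R) = 0. Proof. by rewrite /py mxE. Qed.
Lemma pz_infty : pz (infty R) = 1. Proof. by rewrite /pz mxE. Qed.
Definition inftyE := (px_infty, py_infty, pz_infty).

Section Cvg.
Context (T : Type) (F : set_system T) {FF : Filter F}.

Lemma cvg_vec3 (f g h : T -> R) a b c :
  f @ F --> a -> g @ F --> b -> h @ F --> c ->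
  (fun t => vec3 (f t) (g t) (h t)) @ F --> vec3 a b c.
Proof.
move=> fa gb hc; apply: cvg_entries => i; apply: ord3_ind;
  rewrite mxE; under eq_fun do rewrite mxE /=; by [].
Qed.

Lemma cvg_vec2 (f g : T -> R) a b :
  f @ F --> a -> g @ F --> b ->
  (fun t => vec2 (f t) (g t)) @ F --> vec2 a b.
Proof.
move=> fa gb; apply: cvg_entries => i; apply: ord2_ind;
  rewrite mxE; under eq_fun do rewrite mxE /=; by [].
Qed.

Lemma cvg_px (f : T -> 'rV[R]_3) p : f @ F --> p -> (fun t => px (f t)) @ F --> px p.
Proof. exact: cvg_entry. Qed.
Lemma cvg_py (f : T -> 'rV[R]_3) p : f @ F --> p -> (fun t => py (f t)) @ F --> py p.
Proof. exact: cvg_entry. Qed.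
Lemma cvg_pz (f : T -> 'rV[R]_3) p : f @ F --> p -> (fun t => pz (f t)) @ F --> pz p.
Proof. exact: cvg_entry. Qed.
Lemma cvg_wx (f : T -> 'rV[R]_2) w : f @ F --> w -> (fun t => wx (f t)) @ F --> wx w.
Proof. exact: cvg_entry. Qed.
Lemma cvg_wy (f : T -> 'rV[R]_2) w : f @ F --> w -> (fun t => wy (f t)) @ F --> wy w.
Proof. exact: cvg_entry. Qed.
End Cvg.

End Coordinates.

(** * Stereographic projection and its inverse *)

Section Stereo.
Context {R : realType}.
Implicit Types (p q : 'rV[R]_3) (w : 'rV[R]_2).

Lemma stereoE p : stereo p = vec2 (px p / (1 - pz p)) (py p / (1 - pz p)).
Proof.
apply: eq_vec2; rewrite ?vecE /wx /wy !mxE; congr (p _ _ / _); exact: val_inj.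
Qed.

Definition unstereo w : 'rV[R]_3 :=
  vec3 (2 * wx w / (1 + sqnorm w)) (2 * wy w / (1 + sqnorm w))
       ((sqnorm w - 1) / (1 + sqnorm w)).

Lemma sqnorm1_gt0 w : 0 < 1 + sqnorm w.
Proof. by have := sqnorm_ge0 w; lra. Qed.

Lemma sphereP p : @sphere R p <-> px p ^+ 2 + py p ^+ 2 + pz p ^+ 2 = 1.
Proof. by rewrite /sphere /= sqnorm3. Qed.

Lemma sphere_infty : @sphere R (infty R).
Proof. apply/sphereP; rewrite !inftyE; ring. Qed.

Lemma sphere_pz_lt1 p : @sphere R p -> p <> infty R -> 0 < 1 - pz p.
Proof.
move=> /sphereP Sp pI; rewrite subr_gt0 lt_neqAle; apply/andP; split.
  apply/eqP => p1; apply: pI.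
  have h : px p ^+ 2 + py p ^+ 2 = 0 by rewrite p1 in Sp; lra.
  move/eqP: h; rewrite paddr_eq0 ?sqr_ge0// !sqrf_eq0 => /andP[/eqP h1 /eqP h2].
  by apply: eq_vec3; rewrite !inftyE.
have := sqr_ge0 (px p); have := sqr_ge0 (py p); nra.
Qed.

Lemma pz_neq1 p : pz p != 1 -> p <> infty R.
Proof. by move=> /eqP h e; apply: h; rewrite e !inftyE. Qed.

Lemma unstereo_sphere w : @sphere R (unstereo w).
Proof.
apply/sphereP; rewrite !vecE; have := sqnorm1_gt0 w; rewrite sqnorm2 => h.
field; exact: lt0r_neq0.
Qed.

Lemma pz_unstereo w : 1 - pz (unstereo w) = 2 / (1 + sqnorm w).
Proof.
rewrite !vecE; have := sqnorm1_gt0 w => h; field; exact: lt0r_neq0.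
Qed.

Lemma unstereo_neq w : unstereo w <> infty R.
Proof.
apply: pz_neq1; have := pz_unstereo w; have := sqnorm1_gt0 w => h e.
have : 0 < 2 / (1 + sqnorm w) by apply: divr_gt0.
rewrite -e => {}e; apply/eqP; lra.
Qed.

Lemma unstereoK : cancel unstereo (@stereo R).
Proof.
move=> w; rewrite stereoE pz_unstereo; have := sqnorm1_gt0 w => h.
by apply: eq_vec2; rewrite !vecE; field; rewrite lt0r_neq0.
Qed.

Lemma sqnorm_stereo p : @sphere R p -> p <> infty R ->
  1 + sqnorm (stereo p) = 2 / (1 - pz p).
Proof.
move=> Sp pI; have h := sphere_pz_lt1 Sp pI.
rewrite stereoE sqnorm2 !vecE; move/sphereP : Sp => Sp.
have e : px p ^+ 2 = 1 - py p ^+ 2 - pz p ^+ 2 by lra.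
rewrite !expr_div_n e; field; exact: lt0r_neq0.
Qed.

Lemma stereoK p : @sphere R p -> p <> infty R -> unstereo (stereo p) = p.
Proof.
move=> Sp pI; have h := sphere_pz_lt1 Sp pI; have h2 := sqnorm_stereo Sp pI.
have e : sqnorm (stereo p) - 1 = 2 * pz p / (1 - pz p).
  rewrite (_ : _ - 1 = (1 + sqnorm (stereo p)) - 2); last by ring.
  by rewrite h2; field; rewrite lt0r_neq0.
by apply: eq_vec3; rewrite !vecE ?h2 ?e ?stereoE ?vecE; field; rewrite lt0r_neq0.
Qed.

Lemma cvg_unstereo (T : Type) (F : set_system T) {FF : Filter F}
  (f : T -> 'rV[R]_2) w : f @ F --> w ->
  (fun t => unstereo (f t)) @ F --> unstereo w.
Proof.
move=> fw.
have h : (fun t => 1 + sqnorm (f t)) @ F --> 1 + sqnorm w.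
  by apply: cvgD; [exact: cvg_cst | apply: cvg_sqnorm].
have hV : (fun t => (1 + sqnorm (f t))^-1) @ F --> (1 + sqnorm w)^-1.
  by apply: cvgV => //; rewrite lt0r_neq0// sqnorm1_gt0.
apply: cvg_vec3; apply: cvgM => //.
- by apply: cvgM; [exact: cvg_cst | apply: cvg_wx].
- by apply: cvgM; [exact: cvg_cst | apply: cvg_wy].
- by apply: cvgB; [apply: cvg_sqnorm | exact: cvg_cst].
Qed.

Lemma continuous_unstereo : continuous unstereo.
Proof. move=> w; exact: (@cvg_unstereo _ (nbhs w) _ id w). Qed.

Lemma cvg_stereo (T : Type) (F : set_system T) {FF : Filter F}
  (f : T -> 'rV[R]_3) p : pz p != 1 -> f @ F --> p ->
  (fun t => stereo (f t)) @ F --> stereo p.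
Proof.
move=> p1 fp; rewrite stereoE; under eq_fun do rewrite stereoE.
have hV : (fun t => (1 - pz (f t))^-1) @ F --> (1 - pz p)^-1.
  apply: cvgV; first by rewrite subr_eq0 eq_sym.
  by apply: cvgB; [exact: cvg_cst | apply: cvg_pz].
by apply: cvg_vec2; apply: cvgM => //; [apply: cvg_px | apply: cvg_py].
Qed.

Lemma near_pz_lt1 p : @sphere R p -> p <> infty R ->
  \forall x \near p, pz x < 1.
Proof.
move=> Sp pI; have := sphere_pz_lt1 Sp pI; rewrite subr_gt0 => z1.
have cz : pz q @[q --> p] --> pz p.
  by apply: (@cvg_pz _ _ (nbhs p) _ id p); exact: cvg_id.
by have := cvgr_lt _ cz 1 z1; apply; exact: nbhs_filter.
Qed.

Lemma near_stereo p (W : set 'rV[R]_2) : @sphere R p -> p <> infty R ->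
  nbhs (stereo p) W -> \forall x \near p, x <> infty R /\ W (stereo x).
Proof.
move=> Sp pI nW.
have cs : stereo q @[q --> p] --> stereo p.
  apply: (@cvg_stereo _ (nbhs p) _ id p); last exact: cvg_id.
  by rewrite lt_eqF// -subr_gt0 sphere_pz_lt1.
apply: filterS2 (near_pz_lt1 Sp pI) (cs _ nW) => x x1 Wx; split => //.
by move=> e; rewrite e pz_infty ltxx in x1.
Qed.

Lemma near_infty_stereo (M : R) : \forall p \near infty R,
  @sphere R p -> p <> infty R -> M < sqnorm (stereo p).
Proof.
have d0 : 0 < 2 / (1 + `|M|) by rewrite divr_gt0// ltr_wpDr.
have cz : pz q @[q --> infty R] --> pz (infty R).
  by apply: (@cvg_pz _ _ (nbhs (infty R)) _ id); exact: cvg_id.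
move/cvgrPdist_lt : cz => /(_ _ d0); apply: filterS => p.
rewrite pz_infty => h Sp pI; have z0 := sphere_pz_lt1 Sp pI.
have e := sqnorm_stereo Sp pI; rewrite gtr0_norm// in h.
have : 1 + `|M| < 1 + sqnorm (stereo p).
  by rewrite e ltr_pdivlMr// mulrC -ltr_pdivlMr// ltr_wpDr.
have := ler_norm M; lra.
Qed.

Lemma unstereo_near_infty (e : R) : 0 < e -> exists M : R,
  forall w : 'rV[R]_2, M < sqnorm w -> `|unstereo w - infty R| < e.
Proof.
move=> e0; exists (4 / e ^+ 2) => w Mw; apply: norm_lt_sqnorm => //.
have e2 : 0 < e ^+ 2 by rewrite exprn_gt0.
have w1 := sqnorm1_gt0 w.
have -> : sqnorm (unstereo w - infty R) = 4 / (1 + sqnorm w).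
  have /sphereP Sw := unstereo_sphere w.
  rewrite sqnorm3 !coordE !inftyE.
  transitivity (px (unstereo w) ^+ 2 + py (unstereo w) ^+ 2
    + pz (unstereo w) ^+ 2 - 1 + 2 * (1 - pz (unstereo w))); first by ring.
  by rewrite Sw pz_unstereo; field; rewrite lt0r_neq0.
by rewrite ltr_pdivrMr// mulrC -ltr_pdivrMr//; lra.
Qed.

End Stereo.

(** * C^1 curves *)

Section C1.
Context {R : realType}.

Definition C1at (V : normedModType R) (c : R -> V) (u : R) : Prop :=
  (\forall v \near u, derivable c v 1) /\ {for u, continuous (derive1 c)}.

(** The way in which all the rules below are obtained: the derivative is given
    by a formula near u, and the formula is continuous at u. *)
Lemma C1at_near (V : normedModType R) (f g : R -> V) u :
  (\forall v \near u, is_derive v (1 : R) f (g v)) -> {for u, continuous g} ->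
  C1at f u /\ derive1 f u = g u.
Proof.
move=> fg cg.
have e : \forall v \near u, derive1 f v = g v.
  by near=> v; rewrite derive1E; apply: derive_val; near: v.
have eu : derive1 f u = g u by exact: nbhs_singleton e.
split=> //; split.
  by apply: filterS fg => v h; exact: (@ex_derive _ _ _ _ _ _ _ h).
rewrite /prop_for /continuous_at eu.
apply: cvg_trans cg; apply: near_eq_cvg.
by near=> v; apply/esym; near: v.
Unshelve. all: by end_near. Qed.

Lemma C1at_derivable (V : normedModType R) (c : R -> V) u :
  C1at c u -> derivable c u 1.
Proof. by case=> /nbhs_singleton. Qed.

Lemma derivable1_continuous (V : normedModType R) (c : R -> V) (u : R) :
  derivable c u 1 -> {for u, continuous c}.
Proof. by move=> /derivable1_diffP /differentiable_continuous. Qed.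

Lemma is_derive_entry m n (c : R -> 'M[R]_(m, n)) (u : R) i j :
  derivable c u 1 ->
  is_derive u (1 : R) (fun t => c t i j) (derive1 c u i j).
Proof.
move=> cu; have := derive_mx cu; rewrite -derive1E => ->.
rewrite mxE; apply: derivableP.
by move/derivable_mxP : cu.
Qed.

Lemma is_derive_mx m n (c : R -> 'M[R]_(m, n)) (u : R) (M : 'M[R]_(m, n)) :
  (forall i j, is_derive u (1 : R) (fun t => c t i j) (M i j)) ->
  is_derive u (1 : R) c M.
Proof.
move=> h.
have cu : derivable c u 1 by apply/derivable_mxP => i j; apply: ex_derive.
apply: DeriveDef => //; rewrite derive_mx//; apply/matrixP => i j.
by rewrite mxE; apply: derive_val.
Qed.

Lemma C1_increasing (f : R -> R) u : C1at f u -> 0 < derive1 f u ->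
  exists2 e, 0 < e & forall x y, u - e <= x -> x < y -> y <= u + e -> f x < f y.
Proof.
move=> [df cf] f0.
have : \forall v \near u, derivable f v 1 /\ 0 < derive1 f v.
  near=> v; split; first by near: v.
  by near: v; apply: (cvgr_gt _ cf) => //.
move=> /nbhs_ballP[e /= e0 he].
have inb v : u - e / 2 <= v <= u + e / 2 -> derivable f v 1 /\ 0 < derive1 f v.
  move=> /andP[h1 h2]; apply: he; rewrite /ball/= ltr_norml; apply/andP; split; lra.
exists (e / 2); first by rewrite divr_gt0.
move=> x y ux xy yu.
have dfi z : z \in `]u - e / 2, u + e / 2[%R -> derivable f z 1.
  by rewrite in_itv/= => /andP[z1 z2]; apply: (inb _ _).1; rewrite !ltW.
have dpi z : z \in `]u - e / 2, u + e / 2[%R -> 0 < derive1 f z.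
  by rewrite in_itv/= => /andP[z1 z2]; apply: (inb _ _).2; rewrite !ltW.
have cfi : {within `[u - e / 2, u + e / 2], continuous f}.
  by apply: derivable_within_continuous => z; rewrite in_itv/= => /inb[].
have mono := gtr0_derive1_lt_cc dfi dpi cfi.
apply: mono => //; rewrite in_itv/=.
  by rewrite ux (le_trans (ltW xy)).
by rewrite yu (le_trans ux (ltW xy)).
Unshelve. all: by end_near. Qed.

End C1.

Section C1ops.
Context {R : realType}.
Implicit Types (f g : R -> R) (u : R).

Lemma C1at_is_derive (V : normedModType R) (c : R -> V) u : C1at c u ->
  \forall v \near u, is_derive v (1 : R) c (derive1 c v).
Proof.
case=> h _; apply: filterS h => v cv; rewrite derive1E; exact: derivableP.
Qed.

Lemma C1at_cvg (V : normedModType R) (c : R -> V) u : C1at c u -> c @ u --> c u.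
Proof. by move=> /C1at_derivable/derivable1_continuous. Qed.

Lemma C1_cst (k : R) u : C1at (fun=> k) u /\ derive1 (fun=> k) u = 0.
Proof.
apply: (C1at_near (g := fun=> 0)); last exact: cvg_cst.
by near=> v; apply: is_derive_cst.
Unshelve. all: by end_near. Qed.

Lemma C1_add f g u : C1at f u -> C1at g u ->
  C1at (fun t => f t + g t) u /\
  derive1 (fun t => f t + g t) u = derive1 f u + derive1 g u.
Proof.
move=> cf cg; apply: (C1at_near (g := fun t => derive1 f t + derive1 g t)).
  have hf := C1at_is_derive cf; have hg := C1at_is_derive cg.
  by apply: filterS2 hf hg => v fv gv; exact: (is_deriveD fv gv).
by apply: cvgD; [exact: cf.2 | exact: cg.2].
Qed.

Lemma C1_mul f g u : C1at f u -> C1at g u ->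
  C1at (fun t => f t * g t) u /\
  derive1 (fun t => f t * g t) u = f u * derive1 g u + g u * derive1 f u.
Proof.
move=> cf cg.
apply: (C1at_near (g := fun t => f t * derive1 g t + g t * derive1 f t)).
  have hf := C1at_is_derive cf; have hg := C1at_is_derive cg.
  by apply: filterS2 hf hg => v fv gv; exact: (is_deriveM fv gv).
have f0 : f @ u --> f u := C1at_cvg cf.
have g0 : g @ u --> g u := C1at_cvg cg.
have f1 : derive1 f @ u --> derive1 f u := cf.2.
have g1 : derive1 g @ u --> derive1 g u := cg.2.
by apply: cvgD; apply: cvgM; [exact: f0 | exact: g1 | exact: g0 | exact: f1].
Qed.

Lemma C1_inv f u : f u != 0 -> C1at f u ->
  C1at (fun t => (f t)^-1) u /\
  derive1 (fun t => (f t)^-1) u = - (f u) ^- 2 * derive1 f u.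
Proof.
move=> fu0 cf; have cu := C1at_cvg cf.
apply: (C1at_near (g := fun t => - (f t) ^- 2 * derive1 f t)).
  have hf := C1at_is_derive cf.
  have h0 : \forall v \near u, f v != 0 by exact: (cvgr_neq0 (f u) cu fu0).
  by apply: filterS2 hf h0 => v fv f0; exact: (is_deriveV f0 fv).
apply: cvgM; last exact: cf.2.
apply: cvgN; apply: cvgV; first by rewrite expf_neq0.
by rewrite expr2; apply: cvgM.
Qed.

Lemma C1_mx m n (c : R -> 'M[R]_(m, n)) u :
  (forall i j, C1at (fun t => c t i j) u) -> C1at c u.
Proof.
move=> h.
have [] // := @C1at_near R _ c
  (fun t => \matrix_(i, j) derive1 (fun s => c s i j) t) u.
  have : \forall v \near u, forall i j,
      is_derive v (1 : R) (fun t => c t i j) (derive1 (fun s => c s i j) v).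
    apply: (@filter_forall _ _ _ (nbhs u) (nbhs_filter u)) => i.
    apply: (@filter_forall _ _ _ (nbhs u) (nbhs_filter u)) => j.
    exact: C1at_is_derive.
  by apply: filterS => v hv; apply: is_derive_mx => i j; rewrite mxE.
apply: cvg_entries => i j; rewrite mxE; under eq_fun do rewrite mxE.
exact: (h i j).2.
Qed.

Lemma C1_entry m n (c : R -> 'M[R]_(m, n)) u i j : C1at c u ->
  C1at (fun t => c t i j) u /\ derive1 (fun t => c t i j) u = derive1 c u i j.
Proof.
move=> cc; apply: (C1at_near (g := fun t => derive1 c t i j)).
  by case: cc => + _; apply: filterS => v; exact: is_derive_entry.
exact: (@cvg_entry _ _ _ _ _ _ (derive1 c) _ i j cc.2).
Qed.

Lemma C1_mulmx m n p (c : R -> 'M[R]_(m, n)) (M : 'M[R]_(n, p)) u : C1at c u ->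
  C1at (fun t => c t *m M) u /\
  derive1 (fun t => c t *m M) u = derive1 c u *m M.
Proof.
move=> cc; apply: (C1at_near (g := fun t => derive1 c t *m M)); last first.
  by apply: cvg_mulmx; [exact: cc.2 | exact: cvg_cst].
apply: filterS (C1at_is_derive cc) => v [cv cvE].
have h : (fun h => h^-1 *: ((c \o shift v) (h *: (1 : R)) *m M - c v *m M)) @ 0^'
    --> derive1 c v *m M.
  rewrite (_ : (fun h => _) =
      (fun h => (h^-1 *: ((c \o shift v) (h *: (1 : R)) - c v)) *m M)).
    by apply: cvg_mulmx; [rewrite -cvE; exact: cv | exact: cvg_cst].
  by apply/funext => h; rewrite -scalemxAl mulmxBl.
apply: DeriveDef; first by apply/cvg_ex; exists (derive1 c v *m M).
exact: (cvg_lim _ h).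
Qed.

(** At the ends of [0, 1] only one side is known; but a nonzero derivative would
    make f strictly monotone on both sides of u, one of which meets [0, 1]. *)
Lemma C1_const_segment f u k : 0 <= u <= 1 -> C1at f u ->
  (forall t, 0 <= t <= 1 -> f t = k) -> derive1 f u = 0.
Proof.
move=> /andP[u0 u1] cf fk.
have not_increasing g : C1at g u -> (forall t, 0 <= t <= 1 -> g t = g u) -> ~ 0 < derive1 g u.
  move=> cg gk /(C1_increasing cg)[e e0 ge].
  have [x [y [h1 h2 h3 x01 y01]]] : exists x y, [/\ u - e <= x, x < y, y <= u + e,
      0 <= x <= 1 & 0 <= y <= 1].
    have [u12|u12] := leP u (1 / 2).
      exists u, (Num.min (u + e) (3 / 4)); split; rewrite ?lt_min ?ge_min ?le_min;
        rewrite ?lexx//; try lra; try (apply/andP; split); try lra.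
    exists (Num.max (u - e) (1 / 4)), u; split; rewrite ?gt_max ?ge_max ?le_max;
      rewrite ?lexx//; try lra; try (apply/andP; split); try lra.
  by have := ge x y h1 h2 h3; rewrite gk// (gk y)// ltxx.
have fu t : 0 <= t <= 1 -> f t = f u by move=> h; rewrite !fk// u0.
apply/eqP; case: ltgtP => // [h|h]; exfalso.
  have [cN dN] := C1_mul (C1_cst (-1) u).1 cf.
  apply: (not_increasing (fun t => -1 * f t)) => //; first by move=> t /fu ->.
  by rewrite dN (C1_cst _ _).2; lra.
exact: (not_increasing f).
Qed.

Lemma C1_lin (c : R -> 'rV[R]_2) (p : 'rV[R]_2) a b u : C1at c u ->
  C1at (fun t => a * wx (c t - p) + b * wy (c t - p)) u /\
  derive1 (fun t => a * wx (c t - p) + b * wy (c t - p)) u =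
  a * wx (derive1 c u) + b * wy (derive1 c u).
Proof.
move=> [dc cc].
apply: (C1at_near (g := fun t => a * wx (derive1 c t) + b * wy (derive1 c t))).
  near=> t.
  have ct : derivable c t 1 by near: t.
  have dx : is_derive t (1 : R) (fun t => wx (c t)) (wx (derive1 c t)).
    exact: is_derive_entry.
  have dy : is_derive t (1 : R) (fun t => wy (c t)) (wy (derive1 c t)).
    exact: is_derive_entry.
  rewrite (_ : (fun t => _) = (a *: (fun t => wx (c t)) + b *: (fun t => wy (c t)))
      + cst (- (a * wx p + b * wy p))); last first.
    apply/funext => s; rewrite !coordE.
    change (a * (wx (c s) - wx p) + b * (wy (c s) - wy p) =
      a * wx (c s) + b * wy (c s) + - (a * wx p + b * wy p)); ring.
  have H := is_deriveD (is_deriveD (is_deriveZ a dx) (is_deriveZ b dy))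
    (is_derive_cst (- (a * wx p + b * wy p)) t 1).
  by apply: (is_derive_eq H); rewrite addr0.
apply: cvgD; (apply: cvgM; first exact: cvg_cst).
  exact: (@cvg_entry _ _ _ _ _ _ (derive1 c) _ ord0 ord0 cc).
exact: (@cvg_entry _ _ _ _ _ _ (derive1 c) _ ord0 ord_max cc).
Unshelve. all: by end_near. Qed.

End C1ops.

(** * The region at the leg of a planar diagram *)

Lemma segment_component (R : realType) (V : normedModType R) (A : set V) (x y : V) :
  (forall t, 0 <= t <= 1 -> A (x + t *: (y - x))) -> connected_component A x y.
Proof.
move=> h; pose g t := x + t *: (y - x).
exists (g @` `[0, 1]).
  split.
  - by exists 0; rewrite /= ?in_itv/= ?lexx ?ler01// /g scale0r addr0.
  - by move=> _ [t t01 <-]; apply: h; move: t01; rewrite /= in_itv.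
  - apply: connected_continuous_connected; first exact: segment_connected.
    apply: continuous_subspaceT => t; apply: cvgD; first exact: cvg_cst.
    by apply: cvgZr_tmp.
by exists 1; rewrite /= ?in_itv/= ?lexx ?ler01// /g scale1r addrC subrK.
Qed.

Section Leg.
Context {R : realType}.
Variable D : diagram 'rV[R]_2.
Hypothesis PD : planar_diagram D.
Let c := curve D.
Let v := derive1 c 0.
Let n := wx v ^+ 2 + wy v ^+ 2.

Let n_gt0 : 0 < n.
Proof.
have v0 : v != 0 by apply: (diagram_immersion PD); rewrite lexx ler01.
rewrite lt0r; apply/andP; split; last by rewrite addr_ge0// sqr_ge0.
apply: contra_neq v0 => /eqP; rewrite paddr_eq0 ?sqr_ge0// !sqrf_eq0.
by move=> /andP[/eqP h1 /eqP h2]; apply: eq_vec2; rewrite coordE.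
Qed.

(* Coordinates along the tangent of the curve at its leg and across it. *)
Let tg (x : 'rV[R]_2) := wx v * wx (x - leg D) + wy v * wy (x - leg D).
Let nm (x : 'rV[R]_2) := - wy v * wx (x - leg D) + wx v * wy (x - leg D).

Let tg_seg x y t : tg (x + t *: (y - x)) = tg x + t * (tg y - tg x).
Proof. by rewrite /tg !coordE; ring. Qed.
Let nm_seg x y t : nm (x + t *: (y - x)) = nm x + t * (nm y - nm x).
Proof. by rewrite /nm !coordE; ring. Qed.

Let pt a b := vec2 (wx (leg D) + (a * wx v - b * wy v) / n)
                   (wy (leg D) + (a * wy v + b * wx v) / n).

Let tg_pt a b : tg (pt a b) = a.
Proof.
by rewrite /tg !coordE !vecE /n; field; exact: lt0r_neq0.
Qed.
Let nm_pt a b : nm (pt a b) = b.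
Proof.
by rewrite /nm !coordE !vecE /n; field; exact: lt0r_neq0.
Qed.
Let tgnm_inj x y : tg x = tg y -> nm x = nm y -> x = y.
Proof.
have h z : z = pt (tg z) (nm z).
  apply: eq_vec2; rewrite !vecE /tg /nm !coordE /n; field; exact: lt0r_neq0.
by move=> e1 e2; rewrite (h x) (h y) e1 e2.
Qed.

(* The coordinate across grows slower than the coordinate along, which moreover
   determines the parameter. *)
Let leg_arc : exists2 e, 0 < e <= 1 &
  (forall u, 0 <= u <= e -> `|nm (c u)| <= tg (c u)) /\
  (forall u w, 0 <= u <= e -> 0 <= w <= e -> tg (c u) = tg (c w) -> u = w).
Proof.
have c1 : C1at c 0.
  by have := (diagram_C1 PD) 0; rewrite lexx ler01 => /(_ isT).
have pos a b : a * wx v + b * wy v = n ->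
    exists2 e, 0 < e & forall x y, 0 <= x -> x < y -> y <= e ->
      a * wx (c x - leg D) + b * wy (c x - leg D)
      < a * wx (c y - leg D) + b * wy (c y - leg D).
  move=> h; have [C dC] := C1_lin (leg D) a b c1.
  have [|e e0 he] := C1_increasing C.
    by rewrite dC -/v h.
  exists e => // x y x0 xy ye; apply: he => //; lra.
(* |nm| <= tg will follow once tg - nm and tg + nm increase from 0. *)
have [|e1 e10 h1] := pos (wx v) (wy v); first by rewrite /n; ring.
have [|e2 e20 h2] := pos (wx v - wy v) (wy v + wx v); first by rewrite /n; ring.
have [|e3 e30 h3] := pos (wx v + wy v) (wy v - wx v); first by rewrite /n; ring.
have [e [e0 e1' ee1 ee2 ee3]] : exists e, [/\ 0 < e, e <= 1, e <= e1, e <= e2 & e <= e3].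
  exists (Num.min 1 (Num.min e1 (Num.min e2 e3))).
  by split; rewrite ?lt_min ?ge_min ?lexx ?orbT ?ltr01 ?e10 ?e20 ?e30.
have c00 : tg (c 0) = 0 /\ nm (c 0) = 0 by rewrite /tg /nm -/c /leg subrr !coordE; split; ring.
exists e; first by rewrite e0.
split.
  move=> u /andP[]; rewrite le_eqVlt => /predU1P[<- _|u0 ue].
    by case: c00 => -> ->; rewrite normr0.
  have := h2 0 u (lexx _) u0 (le_trans ue ee2).
  have := h3 0 u (lexx _) u0 (le_trans ue ee3).
  move: c00; rewrite /tg /nm ler_norml => -[h h'] k1 k2; apply/andP; split; lra.
move=> u w /andP[u0 ue] /andP[w0 we] tuw.
have [uw|uw|//] := ltgtP u w.
  by have := h1 u w u0 uw (le_trans we ee1); rewrite -/(tg _) -/(tg _) tuw ltxx.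
by have := h1 w u w0 uw (le_trans ue ee1); rewrite -/(tg _) -/(tg _) tuw ltxx.
Qed.

Let c_continuous u : 0 <= u <= 1 -> {for u, continuous c}.
Proof.
by move=> /(diagram_C1 PD)/C1at_derivable/derivable1_continuous.
Qed.

Let cvg_tg (T : Type) (F : set_system T) {FF : Filter F} (f : T -> 'rV[R]_2) p :
  f @ F --> p -> (fun t => tg (f t)) @ F --> tg p.
Proof.
move=> fp; rewrite /tg; apply: cvgD; apply: cvgM; try exact: cvg_cst.
- by apply: cvg_wx; apply: cvgB => //; exact: cvg_cst.
- by apply: cvg_wy; apply: cvgB => //; exact: cvg_cst.
Qed.

Let cvg_nm (T : Type) (F : set_system T) {FF : Filter F} (f : T -> 'rV[R]_2) p :
  f @ F --> p -> (fun t => nm (f t)) @ F --> nm p.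
Proof.
move=> fp; rewrite /nm; apply: cvgD; apply: cvgM; try exact: cvg_cst.
- by apply: cvg_wx; apply: cvgB => //; exact: cvg_cst.
- by apply: cvg_wy; apply: cvgB => //; exact: cvg_cst.
Qed.

(* The rest of the curve stays away from the leg, as no crossing is there. *)
Let leg_box : exists2 r, 0 < r &
  forall u, 0 <= u <= 1 -> `|tg (c u)| < r -> `|nm (c u)| < r ->
    `|nm (c u)| <= tg (c u) /\
    forall w, 0 <= w <= 1 -> `|tg (c w)| < r -> `|nm (c w)| < r ->
      tg (c u) = tg (c w) -> u = w.
Proof.
have [e /andP[e0 e1] [h1 h2]] := leg_arc.
pose g u := tg (c u) * tg (c u) + nm (c u) * nm (c u).
have cg : {within `[e, 1], continuous g}.
  apply: continuous_in_subspaceT => u; rewrite inE /= in_itv/= => /andP[eu u1].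
  have cu : {for u, continuous c} by apply: c_continuous; rewrite u1 (le_trans (ltW e0)).
  rewrite /g.
  have ct := @cvg_tg _ _ _ _ _ cu.
  have cn := @cvg_nm _ _ _ _ _ cu.
  rewrite /prop_for /continuous_at.
  apply: cvgD; apply: cvgM; [exact: ct|exact: ct|exact: cn|exact: cn].
have [m me1 hm] := EVT_min e1 cg.
have gm : 0 < g m.
  move: me1; rewrite in_itv/= => /andP[em m1].
  rewrite /g -!expr2 lt0r; apply/andP; split; last by rewrite addr_ge0// sqr_ge0.
  apply/negP; rewrite paddr_eq0 ?sqr_ge0// !sqrf_eq0 => /andP[/eqP t0 /eqP n0].
  apply: (diagram_leg PD (u := m)); split.
  - by rewrite lexx ler01.
  - by rewrite m1 (le_trans (ltW e0)).
  - by rewrite lt_eqF// (lt_le_trans e0).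
  - apply: tgnm_inj; rewrite -/c ?t0 ?n0.
      by rewrite /tg /c /leg subrr !coordE; ring.
    by rewrite /nm /c /leg subrr !coordE; ring.
pose r := Num.min 1 (g m / 2).
have r0 : 0 < r by rewrite lt_min ltr01 divr_gt0.
have small u : 0 <= u <= 1 -> `|tg (c u)| < r -> `|nm (c u)| < r -> 0 <= u <= e.
  move=> /andP[u0 u1] tr nr; rewrite u0 /= leNgt; apply/negP => eu.
  have := hm u; rewrite in_itv/= u1 (ltW eu) => /(_ isT).
  rewrite /g -!expr2 -(real_normK (num_real (tg (c u)))) -(real_normK (num_real (nm (c u)))) -/(g m).
  have rr : r <= 1 /\ r <= g m / 2 by rewrite /r !ge_min !lexx orbT.
  have := normr_ge0 (tg (c u)); have := normr_ge0 (nm (c u)).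
  case: rr; nra.
exists r => // u u01 tr nr; split; first by apply: h1; apply: small.
by move=> w w01 tw nw; apply: h2; apply: small.
Qed.

(** Behind the leg, against the direction of the curve, there is no graph. *)
Lemma leg_approach W : nbhs (leg D) W ->
  exists x, W x /\ (@plane R `\` graph D) x.
Proof.
have [r r0 hr] := leg_box; move=> WD.
have : (fun s => pt (- s) 0) @ (0 : R) --> leg D.
  rewrite (_ : leg D = pt (- 0) 0); last first.
    by apply: tgnm_inj; rewrite ?tg_pt ?nm_pt /tg /nm subrr !coordE; ring.
  apply: cvg_vec2; (apply: cvgD; first exact: cvg_cst);
  apply: cvgM; try exact: cvg_cst.
    apply: cvgB; last exact: cvg_cst.
    by apply: cvgM; [apply: cvgN; exact: cvg_id | exact: cvg_cst].
  apply: cvgD; last exact: cvg_cst.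
  by apply: cvgM; [apply: cvgN; exact: cvg_id | exact: cvg_cst].
move=> /(_ _ WD) /nbhs_ballP[d /= d0 hd].
pose s := Num.min (d / 2) (r / 2).
have s0 : 0 < s by rewrite lt_min !divr_gt0.
have sd : s < d by rewrite /s gt_min; apply/orP; left; lra.
have sr : s < r by rewrite /s gt_min; apply/orP; right; lra.
exists (pt (- s) 0); split.
  by apply: hd; rewrite /ball/= sub0r normrN gtr0_norm.
split=> // -[u /=]; rewrite in_itv/= => u01 ue.
have [] := hr u u01; rewrite -/c in ue.
- by rewrite ue tg_pt normrN gtr0_norm.
- by rewrite ue nm_pt normr0.
- rewrite ue tg_pt nm_pt normr0 => h _; lra.
Qed.

(** The complement of the graph is locally in one piece at the leg, so that the
    leg touches a single region.  In a small box around the leg the graph lies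
    in the cone |nm| <= tg and each line tg = const meets it at most once.  From
    any point off the graph one can therefore move across the curve, upwards or
    downwards, out of the cone, then back along the curve to tg < 0, and there
    straight to a base point. *)
Lemma leg_connected : exists N z, nbhs (leg D) N /\
  forall x, N x -> ~ graph D x -> connected_component (@plane R `\` graph D) z x.
Proof.
have [r r0 hr] := leg_box.
pose N := [set x | `|tg x| < r /\ `|nm x| < r].
exists N, (pt (- r / 2) 0); split.
  have t0 : tg (leg D) = 0 by rewrite /tg subrr !coordE; ring.
  have n0 : nm (leg D) = 0 by rewrite /nm subrr !coordE; ring.
  have ct0 : tg x @[x --> leg D] --> tg (leg D).
    by apply: (@cvg_tg _ (nbhs (leg D)) _ id (leg D)); exact: cvg_id.
  have cn0 : nm x @[x --> leg D] --> nm (leg D).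
    by apply: (@cvg_nm _ (nbhs (leg D)) _ id (leg D)); exact: cvg_id.
  have ct := cvg_norm ct0; have {}ct := ct (nbhs_filter _).
  have cn := cvg_norm cn0; have {}cn := cn (nbhs_filter _).
  have ht : `|tg (leg D)| < r by rewrite t0 normr0.
  have hn : `|nm (leg D)| < r by rewrite n0 normr0.
  have h1 := cvgr_lt _ ct r ht.
  have h2 := cvgr_lt _ cn r hn.
  exact: (filterI (h1 (nbhs_filter _)) (h2 (nbhs_filter _))).
move=> x [tx nx] Gx; apply: connected_component_sym.
have Gbox y : graph D y -> `|tg y| < r -> `|nm y| < r -> `|nm y| <= tg y.
  by move=> [u /=]; rewrite in_itv/= => u01 <- h1 h2; have [] := hr u u01 h1 h2.
have Ginj y z : graph D y -> graph D z -> `|tg y| < r -> `|nm y| < r ->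
    `|tg z| < r -> `|nm z| < r -> tg y = tg z -> y = z.
  move=> [u /=]; rewrite in_itv/= => u01 <- [w /=]; rewrite in_itv/= => w01 <-.
  move=> h1 h2 h3 h4 e; have [_ h] := hr u u01 h1 h2.
  by rewrite (h w w01 h3 h4 e).
(* Any height strictly between that of x and r. *)
pose h := (Num.max `|tg x| `|nm x| + r) / 2.
have mxr : Num.max `|tg x| `|nm x| < r by rewrite gt_max tx nx.
have hr' : h < r by rewrite /h; lra.
have mh : Num.max `|tg x| `|nm x| < h by rewrite /h; lra.
have th : `|tg x| < h by move: mh; rewrite gt_max => /andP[].
have nh : `|nm x| < h by move: mh; rewrite gt_max => /andP[].
have h0 : 0 < h by apply: le_lt_trans th.
move: th nh; rewrite !ltr_norml => /andP[th1 th2] /andP[nh1 nh2].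
(* The two segments cannot both meet the graph: they would do so in the same
   point, which is x itself. *)
have vert : exists2 s : R, s = 1 \/ s = -1 & forall t, 0 <= t <= 1 ->
    ~ graph D (x + t *: (pt (tg x) (s * h) - x)).
  apply: contrapT => noseg.
  have seg s : s = 1 \/ s = -1 -> exists2 t, 0 <= t <= 1 &
      graph D (x + t *: (pt (tg x) (s * h) - x)).
    move=> s1; apply: contrapT => nt; apply: noseg; exists s => // t t01 Gt.
    by apply: nt; exists t.
  have [t /andP[t0 t1] G1] := seg 1 (or_introl erefl).
  have [s /andP[s0 s1] G2] := seg (-1) (or_intror erefl).
  have e : x + t *: (pt (tg x) (1 * h) - x) = x + s *: (pt (tg x) (-1 * h) - x).
    apply: Ginj => //; rewrite ?tg_seg ?nm_seg ?tg_pt ?nm_pt;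
      rewrite ?ltr_norml; try (apply/andP; split); nra.
  have := congr1 nm e; rewrite !nm_seg !nm_pt => en.
  have t00 : t = 0 by nra.
  by apply: Gx; move: G1; rewrite t00 scale0r addr0.
have [s s1 vs] := vert.
apply: (connected_component_trans (y := pt (tg x) (s * h))).
  by apply: segment_component => t t01; split => //; apply: vs.
apply: (connected_component_trans (y := pt (- h / 2) (s * h))).
  apply: segment_component => t /andP[t0 t1]; split => // G.
  have := Gbox _ G; rewrite tg_seg nm_seg !tg_pt !nm_pt subrr mulr0 addr0.
  have -> : `|s * h| = h by case: s1 => ->; rewrite ?mul1r ?mulN1r ?normrN gtr0_norm.
  rewrite !ltr_norml hr' => H.
  have : h <= tg x + t * (- h / 2 - tg x).
    by apply: H => //; apply/andP; split; nra.
  nra.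
apply: segment_component => t /andP[t0 t1]; split => // G.
have := Gbox _ G; rewrite tg_seg nm_seg !tg_pt !nm_pt => H.
have : `|s * h + t * (0 - s * h)| <= - h / 2 + t * (- r / 2 - - h / 2).
  have [k1 k2] : - h <= s * h /\ s * h <= h by case: s1 => ->; split; lra.
  by move: (s * h) k1 k2 H => k k1 k2; apply; rewrite ltr_norml; apply/andP; split; nra.
have := normr_ge0 (s * h + t * (0 - s * h)); nra.
Qed.

End Leg.

(** * Carrying diagrams and Reidemeister moves along a map *)

Section Transfer.
Context {R : realType}.

Definition map_diagram (V W : normedModType R) (T : V -> W) (D : diagram V) :
  diagram W := Diagram (T \o curve D) (over D).

Section Knotoid.
Variables (V W : normedModType R) (Sigma : set V) (Sigma' : set W) (T : V -> W).
Variable D : diagram V.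
Let c := curve D.

Lemma crossing_map u v :
  (forall u v, 0 <= u <= 1 -> 0 <= v <= 1 -> T (c u) = T (c v) -> c u = c v) ->
  crossing (map_diagram T D) u v <-> crossing D u v.
Proof.
move=> inj; split=> -[u01 v01 uv e]; split=> //; first exact: inj.
by rewrite /= e.
Qed.

(** The last hypothesis is what the differential of T has to satisfy: it gives
    the immersion (v = u, b = 0) and transversality at the crossings. *)
Lemma knotoid_diagram_map :
  knotoid_diagram Sigma D ->
  (forall u, 0 <= u <= 1 -> Sigma' (T (c u))) ->
  (forall u v, 0 <= u <= 1 -> 0 <= v <= 1 -> T (c u) = T (c v) -> c u = c v) ->
  (forall u, 0 <= u <= 1 -> C1at (T \o c) u) ->
  (forall u v a b, 0 <= u <= 1 -> 0 <= v <= 1 -> c u = c v ->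
     a *: derive1 (T \o c) u + b *: derive1 (T \o c) v = 0 ->
     a *: derive1 c u + b *: derive1 c v = 0) ->
  knotoid_diagram Sigma' (map_diagram T D).
Proof.
move=> KD S' inj C1T lin; have cr u v := crossing_map u v inj; split.
- exact: S'.
- exact: C1T.
- move=> u u01; apply/eqP => d0; have /eqP := diagram_immersion KD u01; apply.
  have := lin u u 1 0 u01 u01 erefl; rewrite !scale1r !scale0r !addr0; exact.
- move=> u v w /cr h1 /cr h2; exact: diagram_double KD _ _ _ h1 h2.
- move=> u v /cr h a b e; apply: (diagram_transversal KD h).
  by case: h => u01 v01 _ e'; apply: lin.
- have i0 : 0 <= (0 : R) <= 1 by rewrite lexx ler01.
  have i1 : 0 <= (1 : R) <= 1 by rewrite lexx ler01.
  by move=> /(inj _ _ i0 i1); exact: diagram_endpoints KD.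
- move=> u h; exact: (diagram_leg KD ((cr _ _).1 h)).
- move=> u h; exact: (diagram_head KD ((cr _ _).1 h)).
- move=> u v h; exact: (diagram_over KD ((cr _ _).1 h)).
Qed.

End Knotoid.

Section Reidemeister.
Variables (V W : normedModType R) (A : set V) (Sigma' : set W) (T : V -> W).
Hypothesis TA : forall x, A x -> Sigma' (T x).
Hypothesis Tinj : forall x y, A x -> A y -> T x = T y -> x = y.
Hypothesis Tcts : forall x, A x -> T @ within A (nbhs x) --> T x.
Variables (D D' : diagram V).
Hypothesis AD : forall u, 0 <= u <= 1 -> A (curve D u).
Hypothesis AD' : forall u, 0 <= u <= 1 -> A (curve D' u).

Let cr u v : crossing (map_diagram T D) u v <-> crossing D u v.
Proof. by apply: crossing_map => s t s01 t01; apply: Tinj; apply: AD. Qed.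
Let cr' u v : crossing (map_diagram T D') u v <-> crossing D' u v.
Proof. by apply: crossing_map => s t s01 t01; apply: Tinj; apply: AD'. Qed.

Let image_mem (phi : 'rV[R]_2 -> V) (B : set 'rV[R]_2) x :
  (forall y, B y -> A (phi y)) -> A x ->
  ((T \o phi) @` B) (T x) <-> (phi @` B) x.
Proof.
move=> Bphi Ax; split=> [[y By e]|[y By <-]]; last by exists y.
by exists y => //; apply: Tinj => //; apply: Bphi.
Qed.

Let tangle_map n (a b : 'I_n -> R) phi E :
  (forall u, 0 <= u <= 1 -> A (curve E u)) -> embedded_disc A phi ->
  tangle a b phi E -> tangle a b (T \o phi) (map_diagram T E).
Proof.
move=> AE [phiA _ _] tE u u01; have [t1 t2] := tE u u01.
split.
  rewrite -t1; apply: image_mem => //; exact: AE.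
rewrite -t2; apply: image_mem; last exact: AE.
by move=> y By; apply: phiA; apply: ltW.
Qed.

Let local_change_map n (a b : 'I_n -> R) : local_change A a b D D' ->
  local_change Sigma' a b (map_diagram T D) (map_diagram T D').
Proof.
case=> ab disj [phi [ephi tD tD']] off ov; split => //.
- exists (T \o phi); split; [|exact: tangle_map|exact: tangle_map].
  case: ephi => phiA phic phii; split.
  + by move=> x /phiA /TA.
  + apply/subspace_continuousP => x Bx.
    apply: (within_comp (B := A)); first exact: phiA.
      by move/subspace_continuousP : phic; apply.
    exact/Tcts/phiA.
  + move=> x y; rewrite !inE => Bx By e; apply: phii; rewrite ?inE//.
    by apply: Tinj => //; apply: phiA.
- by move=> u u01 ou /=; rewrite off.
- by move=> u v /cr; exact: ov.
Qed.

Let no_crossing_map n (a b : 'I_n -> R) : no_crossing_inside a b D ->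
  no_crossing_inside a b (map_diagram T D).
Proof. by move=> h u v iu /cr; exact: h. Qed.

(** A move is described by a disc and by crossings, so that any embedding of a
    set containing the disc and both diagrams carries it along. *)
Lemma reidemeister_map : reidemeister A D D' ->
  reidemeister Sigma' (map_diagram T D) (map_diagram T D').
Proof.
case.
- move=> [a [b [lc nc [p [q [ip cpq h]]]]]]; apply: Or31; exists a, b; split.
  + exact: local_change_map.
  + exact: no_crossing_map.
  + exists p, q; split => //; first exact/cr'.
    by move=> u v iu /cr'; exact: h.
- move=> [a [b [lc nc [p [q [p' [q' [ip [c1 o1] [c2 o2] h]]]]]]]]; apply: Or32; exists a, b; split.
  + exact: local_change_map.
  + exact: no_crossing_map.
  + exists p, q, p', q'; split => //; try by split => //; exact/cr'.
    by move=> u v iu /cr'; exact: h.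
- move=> [a [b [c [c' [lc [t1 t2 t3] [t1' t2' t3'] h]]]]]; apply: Or33; exists a, b, c, c'; split => //.
  + exact: local_change_map.
  + split=> // [i j ij|u v iu /cr]; last exact: t3.
    by have [? ?] := t1 i j ij; split => //; exact/cr.
  + split=> // [i j ij|u v iu /cr']; last exact: t3'.
    by have [? ?] := t1' i j ij; split => //; exact/cr'.
Qed.

End Reidemeister.

(** The disc of a move is compact and misses the leg.  For a point p off the
    disc, for instance near the leg, the move takes place in Sigma minus p. *)
Lemma reidemeister_avoid (V : normedModType R) (Sigma : set V) (D D' : diagram V) :
  reidemeister Sigma D D' ->
  exists K : set V, [/\ closed K, ~ K (leg D),
    forall u, 0 <= u <= 1 ->
      curve D' u = curve D u \/ K (curve D u) /\ K (curve D' u) &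
    forall p, ~ K p -> reidemeister (Sigma `\ p) D D'].
Proof.
have lcK n (a b : 'I_n -> R) : local_change Sigma a b D D' ->
  exists K : set V, [/\ closed K, ~ K (leg D),
    forall u, 0 <= u <= 1 ->
      curve D' u = curve D u \/ K (curve D u) /\ K (curve D' u) &
    forall p, ~ K p -> local_change (Sigma `\ p) a b D D'].
  case=> ab disj [phi [[phiS phic phii] tD tD']] off ov.
  exists (phi @` @closed_disc R); split.
  - apply: compact_closed; first exact: norm_hausdorff.
    by apply: continuous_compact => //; exact: compact_sqnorm_le.
  - have [|+ _] := tD 0; first by rewrite lexx ler01.
    move=> [+ _] => /[apply] -[i /andP[a0 _]].
    by have /and3P[] := ab i; rewrite ltNge a0.
  - move=> u u01; have [h|h] := pselect (exists i, a i < u < b i); last first.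
      by left; apply: off => // i iu; apply: h; exists i.
    have iu : inside a b u by case: h => i /andP[h1 h2]; exists i; rewrite !ltW.
    by right; split; [have [[_ + ] _] := tD u u01|have [[_ + ] _] := tD' u u01]; apply.
  - move=> p Kp; split => //; exists phi; split => //; split => // x Bx.
    by split; [exact: phiS | move=> e; apply: Kp; exists x].
case.
- move=> [a [b [/lcK[K [K1 K2 K3 K4]] nc h]]]; exists K; split => // p Kp.
  by apply: Or31; exists a, b; split => //; apply: K4.
- move=> [a [b [/lcK[K [K1 K2 K3 K4]] nc h]]]; exists K; split => // p Kp.
  by apply: Or32; exists a, b; split => //; apply: K4.
- move=> [a [b [c [c' [/lcK[K [K1 K2 K3 K4]] t1 t2 h]]]]]; exists K; split => // p Kp.
  by apply: Or33; exists a, b, c, c'; split => //; apply: K4.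
Qed.

End Transfer.

(** * Projecting, lifting and rotating diagrams *)

Section Instances.
Context {R : realType}.

Lemma sphere_tangent (c : R -> 'rV[R]_3) u : 0 <= u <= 1 -> C1at c u ->
  (forall t, 0 <= t <= 1 -> @sphere R (c t)) ->
  px (c u) * px (derive1 c u) + py (c u) * py (derive1 c u)
  + pz (c u) * pz (derive1 c u) = 0.
Proof.
move=> u01 cc cS.
have [x1 x2] := C1_entry ord0 ord0 cc.
have [y1 y2] := C1_entry ord0 (lift ord0 ord0) cc.
have [z1 z2] := C1_entry ord0 ord_max cc.
have [xx1 xx2] := C1_mul x1 x1.
have [yy1 yy2] := C1_mul y1 y1.
have [zz1 zz2] := C1_mul z1 z1.
have [s1 s2] := C1_add xx1 yy1.
have [t1 t2] := C1_add s1 zz1.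
have := C1_const_segment (k := 1) u01 t1.
rewrite t2 s2 xx2 yy2 zz2 x2 y2 z2 => h.
have half (p q r p' q' r' : R) :
    p * p' + p * p' + (q * q' + q * q') + (r * r' + r * r') = 0 ->
    p * p' + q * q' + r * r' = 0 by move=> e; lra.
by apply: half; apply: h => t t01; apply/sphereP; exact: cS.
Qed.

(** The differential of the stereographic projection at p. *)
Definition dstereo (p v : 'rV[R]_3) : 'rV[R]_2 :=
  vec2 ((px v * (1 - pz p) + px p * pz v) / (1 - pz p) ^+ 2)
       ((py v * (1 - pz p) + py p * pz v) / (1 - pz p) ^+ 2).

Lemma dstereo_lin p (v w : 'rV[R]_3) a b :
  a *: v + b *: w = 0 -> a *: dstereo p v + b *: dstereo p w = 0.
Proof.
move=> h.
have key (x k k2 p1 p3 q1 q3 : R) : a * p1 + b * q1 = 0 -> a * p3 + b * q3 = 0 ->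
    a * ((p1 * k + x * p3) / k2) + b * ((q1 * k + x * q3) / k2) = 0.
  move=> h1 h2; transitivity (k / k2 * (a * p1 + b * q1) + x / k2 * (a * p3 + b * q3)).
    by ring.
  by rewrite h1 h2; ring.
have hx := congr1 px h; rewrite !coordE in hx.
have hy := congr1 py h; rewrite !coordE in hy.
have hz := congr1 pz h; rewrite !coordE in hz.
by apply: eq_vec2; rewrite !coordE !vecE; apply: key.
Qed.

(** The kernel of dstereo p is the line of p - infty, which is not tangent to the
    sphere at p. *)
Lemma dstereo_inj p (v w : 'rV[R]_3) a b : @sphere R p -> p <> infty R ->
  px p * px v + py p * py v + pz p * pz v = 0 ->
  px p * px w + py p * py w + pz p * pz w = 0 ->
  a *: dstereo p v + b *: dstereo p w = 0 -> a *: v + b *: w = 0.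
Proof.
move=> Sp pI tv tw h.
have := sphere_pz_lt1 Sp pI.
move/sphereP : Sp => Sp; rewrite /dstereo in h *.
set k := 1 - pz p in h * => k0.
have k2 : k ^+ 2 != 0 by rewrite expf_neq0// lt0r_neq0.
have clear A B : a * (A / k ^+ 2) + b * (B / k ^+ 2) = 0 -> a * A + b * B = 0.
  rewrite !mulrA -mulrDl => /eqP; rewrite mulf_eq0 invr_eq0 (negPf k2) orbF.
  by move=> /eqP.
have hx := congr1 wx h; rewrite !coordE !vecE in hx; move/clear : hx => hx.
have hy := congr1 wy h; rewrite !coordE !vecE in hy; move/clear : hy => hy.
set X := a * px v + b * px w; set Y := a * py v + b * py w.
set Z := a * pz v + b * pz w.
have eX : X * k + px p * Z = 0 by rewrite -hx /X /Z; ring.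
have eY : Y * k + py p * Z = 0 by rewrite -hy /Y /Z; ring.
have eT : px p * X + py p * Y + pz p * Z = 0.
  transitivity (a * (px p * px v + py p * py v + pz p * pz v)
    + b * (px p * px w + py p * py w + pz p * pz w)).
    by rewrite /X /Y /Z; ring.
  by rewrite tv tw; ring.
have kn : k == 0 = false by rewrite gt_eqF.
have Z0 : Z = 0.
  have : k * Z = 0.
    transitivity (px p * (X * k + px p * Z) + py p * (Y * k + py p * Z)
      - k * (px p * X + py p * Y + pz p * Z)
      + Z * (1 - (px p ^+ 2 + py p ^+ 2 + pz p ^+ 2))).
      by rewrite /k; ring.
    by rewrite eX eY eT Sp; ring.
  by move=> /eqP; rewrite mulf_eq0 kn => /eqP.
have X0 : X = 0.
  by move: eX; rewrite Z0 mulr0 addr0 => /eqP; rewrite mulf_eq0 kn orbF => /eqP.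
have Y0 : Y = 0.
  by move: eY; rewrite Z0 mulr0 addr0 => /eqP; rewrite mulf_eq0 kn orbF => /eqP.
by apply: eq_vec3; rewrite !coordE.
Qed.

Lemma C1_stereo (c : R -> 'rV[R]_3) u : pz (c u) != 1 -> C1at c u ->
  C1at (fun t => stereo (c t)) u /\
  derive1 (fun t => stereo (c t)) u = dstereo (c u) (derive1 c u).
Proof.
move=> cu1 cc.
have [x1 x2] := C1_entry ord0 ord0 cc.
have [y1 y2] := C1_entry ord0 (lift ord0 ord0) cc.
have [z1 z2] := C1_entry ord0 ord_max cc.
have [m1 m2] := C1_mul (C1_cst (-1) u).1 z1.
pose w t := 1 + -1 * c t ord0 ord_max.
have [w1 w2] : C1at w u /\ derive1 w u = _ := C1_add (C1_cst 1 u).1 m1.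
have w0 : w u != 0.
  by rewrite /w mulN1r subr_eq0 eq_sym.
have [v1 v2] := C1_inv w0 w1.
have [a1 a2] := C1_mul x1 v1.
have [b1 b2] := C1_mul y1 v1.
have ex : (fun t => stereo (c t) ord0 ord0) =
   (fun t => c t ord0 ord0 * (w t)^-1).
  by apply/funext => t; rewrite stereoE -/(wx _) vecE /w mulN1r.
have ey : (fun t => stereo (c t) ord0 ord_max) =
   (fun t => c t ord0 (lift ord0 ord0) * (w t)^-1).
  by apply/funext => t; rewrite stereoE -/(wy _) vecE /w mulN1r.
have C : C1at (fun t => stereo (c t)) u.
  apply: C1_mx => i j; rewrite (ord1 i); move: j.
  by apply: ord2_ind; [rewrite ex|rewrite ey].
have k : 1 - pz (c u) != 0 by rewrite subr_eq0 eq_sym.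
split => //; apply: eq_vec2; rewrite vecE.
  rewrite /wx -(C1_entry _ _ C).2 ex a2 v2 x2 w2 m2 z2 !(C1_cst _ _).2.
  rewrite /w /px /pz mulN1r in k *.
  move: (derive1 c u ord0 ord0) (derive1 c u ord0 ord_max) => dx dz.
  by field.
rewrite /wy -(C1_entry _ _ C).2 ey b2 v2 y2 w2 m2 z2 !(C1_cst _ _).2.
rewrite /w /py /pz mulN1r in k *.
move: (derive1 c u ord0 _) (derive1 c u ord0 ord_max) => dx dz.
by field.
Qed.

Lemma C1_unstereo (d : R -> 'rV[R]_2) u : C1at d u ->
  C1at (fun t => unstereo (d t)) u.
Proof.
move=> cd.
have [x1 _] := C1_entry ord0 ord0 cd.
have [y1 _] := C1_entry ord0 ord_max cd.
pose n t := d t ord0 ord0 * d t ord0 ord0 + d t ord0 ord_max * d t ord0 ord_max.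
have n1 : C1at n u := (C1_add (C1_mul x1 x1).1 (C1_mul y1 y1).1).1.
pose s t := 1 + n t.
have s1 : C1at s u := (C1_add (C1_cst 1 u).1 n1).1.
have nE t : sqnorm (d t) = n t by rewrite sqnorm2 !expr2.
have s0 : s u != 0 by rewrite /s -nE lt0r_neq0// sqnorm1_gt0.
have [v1 _] := C1_inv s0 s1.
have [k1 _] := C1_add n1 (C1_cst (-1) u).1.
have [a1 _] := C1_mul (C1_mul (C1_cst 2 u).1 x1).1 v1.
have [b1 _] := C1_mul (C1_mul (C1_cst 2 u).1 y1).1 v1.
have [c1 _] := C1_mul k1 v1.
apply: C1_mx => i j; rewrite (ord1 i); move: j; apply: ord3_ind.
- rewrite (_ : (fun t => _) = (fun t => 2 * d t ord0 ord0 * (s t)^-1))//.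
  by apply/funext => t; rewrite -/(px _) vecE nE.
- rewrite (_ : (fun t => _) = (fun t => 2 * d t ord0 ord_max * (s t)^-1))//.
  by apply/funext => t; rewrite -/(py _) vecE nE.
- rewrite (_ : (fun t => _) = (fun t => (n t + -1) * (s t)^-1))//.
  by apply/funext => t; rewrite -/(pz _) vecE nE.
Qed.

Lemma graph_off (E : diagram 'rV[R]_3) p u : ~ graph E p -> 0 <= u <= 1 ->
  curve E u <> p.
Proof. by move=> h u01 e; apply: h; exists u; rewrite //= in_itv. Qed.

Lemma planar_stereo (E : diagram 'rV[R]_3) : spherical_diagram E ->
  planar_diagram (stereo_diagram E).
Proof.
move=> [KE Ei]; have off u := graph_off Ei (u := u).
have S u : 0 <= u <= 1 -> @sphere R (curve E u) by exact: diagram_in.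
have z1 u : 0 <= u <= 1 -> 0 < 1 - pz (curve E u).
  by move=> u01; apply: sphere_pz_lt1; [exact: S | exact: off].
have C u : 0 <= u <= 1 -> C1at (curve E) u by exact: (diagram_C1 KE).
have zn u : 0 <= u <= 1 -> pz (curve E u) != 1.
  by move=> /z1; rewrite subr_gt0 => /lt_eqF ->.
apply: (knotoid_diagram_map KE) => //.
- move=> u v u01 v01 e; rewrite -(stereoK (S _ u01) (off _ u01)) e stereoK//.
  + exact: S.
  + exact: off.
- by move=> u u01; have [] := C1_stereo (zn u u01) (C u u01).
move=> u v a b u01 v01 e h.
have tu := sphere_tangent u01 (C u u01) S.
have tv := sphere_tangent v01 (C v v01) S.
rewrite -e in tv.
have du : derive1 (@stereo R \o curve E) u = _ := (C1_stereo (zn u u01) (C u u01)).2.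
have dv : derive1 (@stereo R \o curve E) v = _ := (C1_stereo (zn v v01) (C v v01)).2.
have {}h : a *: dstereo (curve E u) (derive1 (curve E) u)
    + b *: dstereo (curve E u) (derive1 (curve E) v) = 0.
  by rewrite -du e -dv; exact: h.
by apply: (dstereo_inj (p := curve E u)) h => //; [exact: S | exact: off].
Qed.

(** The differential of unstereo is injective because dstereo is a left inverse
    of it along the curve. *)
Lemma spherical_unstereo (D : diagram 'rV[R]_2) : planar_diagram D ->
  spherical_diagram (map_diagram unstereo D).
Proof.
move=> PD; split; last by move=> [u _ /= e]; exact: (unstereo_neq e).
have C u : 0 <= u <= 1 -> C1at (curve D) u by exact: (diagram_C1 PD).
have Cu u : 0 <= u <= 1 -> C1at (fun t => unstereo (curve D t)) u.
  by move=> /C /C1_unstereo.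
have zn u : pz (unstereo (curve D u)) != 1.
  have := pz_unstereo (curve D u); have := sqnorm1_gt0 (curve D u) => h e.
  rewrite eq_sym -subr_eq0 e mulf_neq0// ?invr_eq0 lt0r_neq0//.
apply: (knotoid_diagram_map PD) => //.
- by move=> u u01; exact: unstereo_sphere.
- by move=> u v _ _ /(can_inj unstereoK).
move=> u v a b u01 v01 e h.
have eD : (fun t => stereo (unstereo (curve D t))) = curve D.
  by apply/funext => t; rewrite unstereoK.
have du := (C1_stereo (c := fun t => unstereo (curve D t)) (zn u) (Cu u u01)).2.
have dv := (C1_stereo (c := fun t => unstereo (curve D t)) (zn v) (Cu v v01)).2.
rewrite eD -e in du dv.
by rewrite du dv; apply: dstereo_lin.
Qed.

Definition orthogonal (M : 'M[R]_3) := M *m M^T = 1%:M.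

Lemma sqnorm_orthogonal M (x : 'rV[R]_3) : orthogonal M -> sqnorm (x *m M) = sqnorm x.
Proof.
by move=> oM; rewrite !sqnorm_mx trmx_mul mulmxA -(mulmxA x) oM mulmx1.
Qed.

Lemma sphere_orthogonal M (x : 'rV[R]_3) : orthogonal M ->
  @sphere R x -> @sphere R (x *m M).
Proof. by move=> oM; rewrite /sphere/= sqnorm_orthogonal. Qed.

Lemma mulmx_orthogonalK M n : orthogonal M ->
  cancel (fun x : 'M[R]_(n, 3) => x *m M) (fun x => x *m M^T).
Proof. by move=> oM x; rewrite -mulmxA oM mulmx1. Qed.

Lemma orthogonal_tr M : orthogonal M -> orthogonal M^T.
Proof. by move=> oM; rewrite /orthogonal trmxK; apply: mulmx1C. Qed.

Lemma knotoid_rotate M (E : diagram 'rV[R]_3) : orthogonal M ->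
  knotoid_diagram (@sphere R) E ->
  knotoid_diagram (@sphere R) (map_diagram (mulmxr M) E).
Proof.
move=> oM KE.
have C u : 0 <= u <= 1 -> C1at (curve E) u by exact: (diagram_C1 KE).
have CM u : 0 <= u <= 1 -> _ := fun u01 => C1_mulmx M (C u u01).
apply: (knotoid_diagram_map KE).
- by move=> u /(diagram_in KE) Su; exact: sphere_orthogonal.
- by move=> u v _ _ /(can_inj (mulmx_orthogonalK oM)).
- by move=> u /CM[].
move=> u v a b u01 v01 _.
have -> : derive1 (mulmxr M \o curve E) u = derive1 (curve E) u *m M := (CM u u01).2.
have -> : derive1 (mulmxr M \o curve E) v = derive1 (curve E) v *m M := (CM v v01).2.
rewrite !scalemxAl -mulmxDl => h.
by apply: (can_inj (mulmx_orthogonalK oM)); rewrite h mul0mx.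
Qed.

End Instances.

(** * Continuous families of homeomorphisms *)

Section Families.
Context {R : realType}.

(** Isotopies of A are the families with A = B that start at the identity.
    Allowing two different surfaces lets an isotopy of the plane be written as a
    composite of stereographic projections and a family on the sphere. *)
Definition homeo_family (V W : normedModType R) (A : set V) (B : set W)
    (h : R -> V -> W) (g : R -> W -> V) : Prop :=
  [/\ forall t x, 0 <= t <= 1 -> A x -> B (h t x) /\ g t (h t x) = x,
      forall t y, 0 <= t <= 1 -> B y -> A (g t y) /\ h t (g t y) = y,
      {within `[0, 1] `*` A, continuous (fun z : R * V => h z.1 z.2)} &
      {within `[0, 1] `*` B, continuous (fun z : R * W => g z.1 z.2)}].

Lemma within2P (V W : normedModType R) (A : set V) (h : R -> V -> W) :
  {within `[0, 1] `*` A, continuous (fun z : R * V => h z.1 z.2)} <->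
  forall (t : R) (x : V), 0 <= t <= 1 -> A x ->
    (fun z : R * V => h z.1 z.2) @ within (`[0, 1] `*` A) (nbhs ((t, x) : R * V)) --> h t x.
Proof.
split=> [/subspace_continuousP H t x t01 Ax|H].
  by apply: (H (t, x)); split => //=; rewrite in_itv.
apply/subspace_continuousP => -[t x] [/= + Ax]; rewrite in_itv => t01.
exact: H.
Qed.

Lemma within2_comp (V W U : normedModType R) (A : set V) (B : set W)
    (h : R -> V -> W) (k : R -> W -> U) :
  (forall t x, 0 <= t <= 1 -> A x -> B (h t x)) ->
  {within `[0, 1] `*` A, continuous (fun z : R * V => h z.1 z.2)} ->
  {within `[0, 1] `*` B, continuous (fun z : R * W => k z.1 z.2)} ->
  {within `[0, 1] `*` A, continuous (fun z : R * V => k z.1 (h z.1 z.2))}.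
Proof.
move=> hAB /within2P hc /within2P kc.
apply/(within2P A (fun t x => k t (h t x))) => t x t01 Ax.
pose f (z : R * V) := (z.1, h z.1 z.2).
have H1 z : (`[0, 1] `*` A) z -> (`[0, 1] `*` B) (f z).
  by case: z => s y [/= s01 Ay]; split => //=; apply: hAB => //; rewrite in_itv in s01.
have H2 : f @ within (`[0, 1] `*` A) (nbhs ((t, x) : R * V)) --> f (t, x).
  have H21 : (fun z : R * V => z.1) @ within (`[0, 1] `*` A) (nbhs ((t, x) : R * V)) --> t.
    exact: cvg_within_fst.
  exact: (cvg_pair H21 (hc t x t01 Ax)).
have H3 : (fun z : R * W => k z.1 z.2) @ within (`[0, 1] `*` B) (nbhs (f (t, x)))
    --> k (f (t, x)).1 (f (t, x)).2.
  by apply: kc => //; exact: hAB.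
exact: (within_comp H1 H2 H3).
Qed.

Lemma homeo_family_sym (V W : normedModType R) (A : set V) (B : set W) h g :
  homeo_family A B h g -> homeo_family B A g h.
Proof. by case. Qed.

Lemma homeo_family_comp (V W U : normedModType R) (A : set V) (B : set W)
    (C : set U) h g h' g' :
  homeo_family A B h g -> homeo_family B C h' g' ->
  homeo_family A C (fun t x => h' t (h t x)) (fun t y => g t (g' t y)).
Proof.
case=> h1 g1 hc gc [h2 g2 hc' gc']; split.
- move=> t x t01 Ax; have [Bx e] := h1 t x t01 Ax; have [Cx e'] := h2 t _ t01 Bx.
  by split => //; rewrite e' e.
- move=> t y t01 Cy; have [By e] := g2 t y t01 Cy; have [Ay e'] := g1 t _ t01 By.
  by split => //; rewrite e' e.
- by apply: within2_comp hc hc' => t x t01 /(h1 t x t01)[].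
- by apply: within2_comp gc' gc => t x t01 /(g2 t x t01)[].
Qed.

Lemma homeo_family_puncture (V W : normedModType R) (A : set V) (B : set W) h g a b :
  homeo_family A B h g -> A a -> (forall t, 0 <= t <= 1 -> h t a = b) ->
  homeo_family (A `\ a) (B `\ b) h g.
Proof.
case=> h1 g1 hc gc Aa hab; split.
- move=> t x t01 [Ax xa]; have [Bx e] := h1 t x t01 Ax; split => //; split => //.
  move=> /= hb; apply: xa => /=; rewrite -e hb -(hab t t01).
  by have [_ ->] := h1 t a t01 Aa.
- move=> t y t01 [By yb]; have [Ay e] := g1 t y t01 By; split => //; split => //.
  by move=> /= ga; apply: yb => /=; rewrite -e ga hab.
- by apply: continuous_subspaceW hc => -[t x] [? []].
- by apply: continuous_subspaceW gc => -[t x] [? []].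
Qed.

Lemma homeo_family_stereo :
  homeo_family (@sphere R `\ infty R) (@plane R)
    (fun _ p => stereo p) (fun _ w => unstereo w).
Proof.
split.
- by move=> _ p _ [Sp pI]; split => //; rewrite stereoK.
- move=> _ w _ _; rewrite unstereoK; split => //; split; first exact: unstereo_sphere.
  exact: unstereo_neq.
- apply/(within2P _ (fun _ => @stereo R)) => t p t01 [Sp pI].
  apply: cvg_stereo; first by rewrite lt_eqF// -subr_gt0 sphere_pz_lt1.
  exact: (@cvg_within_snd _ _ _ (_, _)).
- apply/(within2P _ (fun _ => @unstereo R)) => t w t01 _.
  apply: cvg_unstereo.
  exact: (@cvg_within_snd _ _ _ (_, _)).
Qed.

Lemma homeo_family_rotation (L : R -> 'M[R]_3) : continuous L ->
  (forall t, orthogonal (L t)) ->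
  homeo_family (@sphere R) (@sphere R)
    (fun t x => x *m L t) (fun t x => x *m (L t)^T).
Proof.
move=> cL oL.
have fstc (t : R) (x : 'rV[R]_3) : (fun z : R * 'rV[R]_3 => z.1) @ within (`[0, 1] `*` @sphere R) (nbhs (t, x)) --> t.
  exact: (@cvg_within_fst _ _ _ (_, _)).
have sndc (t : R) (x : 'rV[R]_3) : (fun z : R * 'rV[R]_3 => z.2) @ within (`[0, 1] `*` @sphere R) (nbhs (t, x)) --> x.
  exact: (@cvg_within_snd _ _ _ (_, _)).
have Lc (t : R) (x : 'rV[R]_3) : (fun z : R * 'rV[R]_3 => L z.1) @ within (`[0, 1] `*` @sphere R) (nbhs (t, x)) --> L t.
  exact: (cvg_comp _ _ (fstc t x) (cL t)).
split.
- move=> t x _ Sx; split; last exact: mulmx_orthogonalK.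
  exact: sphere_orthogonal.
- move=> t x _ Sx; split; first exact/sphere_orthogonal/Sx/orthogonal_tr.
  have := mulmx_orthogonalK (orthogonal_tr (oL t)) x; by rewrite trmxK.
- by apply/(within2P _ (fun t x => x *m L t)) => t x t01 _; apply: cvg_mulmx.
- by apply/(within2P _ (fun t x => x *m (L t)^T)) => t x t01 _; apply: cvg_mulmx => //; apply: cvg_trmx.
Qed.

Definition extend_infty (h : R -> 'rV[R]_2 -> 'rV[R]_2) (t : R) (p : 'rV[R]_3) :=
  if p == infty R then infty R else unstereo (h t (stereo p)).

Lemma extend_inftyE h t p : p <> infty R ->
  extend_infty h t p = unstereo (h t (stereo p)).
Proof. by rewrite /extend_infty => /eqP/negbTE ->. Qed.

Lemma bounded_sqnorm (A : set 'rV[R]_2) : compact A ->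
  exists M : R, forall w, A w -> sqnorm w <= M.
Proof.
move=> cA; have [->|/set0P A0] := eqVneq A set0; first by exists 0.
have [|c _ hc] := @compact_EVT_max _ R (@sqnorm R 2) A A0 cA.
  exact/continuous_subspaceT/continuous_sqnorm.
by exists (sqnorm c) => w Aw; apply: hc; rewrite inE.
Qed.

(** Continuity at the north pole, uniformly in t: what h t moves into a large disc
    of the plane comes from the image of this disc under the inverses g t, which
    is compact as t ranges over [0, 1]. *)
Lemma homeo_family_extend_cts h g : homeo_family (@plane R) (@plane R) h g ->
  {within `[0, 1] `*` @sphere R,
    continuous (fun z : R * 'rV[R]_3 => extend_infty h z.1 z.2)}.
Proof.
case=> h1 g1 hc gc; apply/within2P => t p t01 Sp.
have [->|pI] := pselect (p = infty R); last first.
  have openI : \forall z \near (t, p), z.2 <> infty R.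
    have nq : \forall q \near p, q <> infty R.
      apply: filterS (near_pz_lt1 Sp pI) => q q1 e.
      by move: q1; rewrite e pz_infty ltxx.
    have := (@cvg_snd _ _ (nbhs t) (nbhs p) _) _ nq.
    exact.
  rewrite extend_inftyE//.
  have H : {within `[0, 1] `*` (@sphere R `\ infty R), continuous
      (fun z : R * 'rV[R]_3 => unstereo (h z.1 (stereo z.2)))}.
    have [s1 s2 sc sc'] := homeo_family_stereo.
    apply: (@within2_comp _ _ _ _ (@plane R) (fun t x => h t (stereo x))
      (fun _ => unstereo)) => //.
    by apply: (@within2_comp _ _ _ _ (@plane R) (fun _ => @stereo R) h).
  move/(within2P _ (fun t p => unstereo (h t (stereo p)))) : H => /(_ t p t01 (conj Sp pI)) H.
  move=> B /H; rewrite /nbhs/= /within/= => HB.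
  apply: filterS2 openI HB => -[s q] /= qI qB [s01 Sq].
  by rewrite extend_inftyE//; apply: qB; split => //.
rewrite {2}/extend_infty eqxx.
apply/cvgrPdist_lt => e e0.
have [M hM] := unstereo_near_infty e0.
have [M' hM'] : exists M' : R, forall s w, 0 <= s <= 1 -> sqnorm (h s w) <= M -> sqnorm w <= M'.
  pose K := (fun z : R * 'rV[R]_2 => g z.1 z.2) @` (`[0, 1] `*` [set w | sqnorm w <= M]).
  have cK : compact K.
    apply: continuous_compact; first by apply: continuous_subspaceW gc => -[s w] [].
    by apply: compact_setX; [exact: segment_compact | exact: compact_sqnorm_le].
  have [M' hM'] := bounded_sqnorm cK; exists M' => s w s01 hw; apply: hM'.
  exists (s, h s w); first by split => //=; rewrite in_itv.
  by have [] := h1 s w s01 I.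
have nz : \forall z \near (t, infty R), @sphere R z.2 -> z.2 <> infty R ->
    M' < sqnorm (stereo z.2).
  have := (@cvg_snd _ _ (nbhs t) (nbhs (infty R)) _) _ (near_infty_stereo M'). exact.
rewrite /within/=; apply: filterS nz => -[s q] /= qM [s01 Sq].
rewrite /extend_infty; case: eqP => [_|qI]; first by rewrite subrr normr0.
rewrite distrC; apply: hM; rewrite ltNge; apply/negP => hle.
have := hM' s (stereo q); rewrite in_itv in s01 => /(_ s01 hle).
by rewrite leNgt qM.
Qed.

Lemma homeo_family_extend h g : homeo_family (@plane R) (@plane R) h g ->
  homeo_family (@sphere R) (@sphere R) (extend_infty h) (extend_infty g).
Proof.
have one h' g' : homeo_family (@plane R) (@plane R) h' g' ->
    forall t x, 0 <= t <= 1 -> @sphere R x -> @sphere R (extend_infty h' t x) /\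
      extend_infty g' t (extend_infty h' t x) = x.
  case=> h1 _ _ _ t x t01 Sx; rewrite {1 3}/extend_infty; case: eqP => [->|xI].
    by rewrite /extend_infty eqxx; split => //; exact: sphere_infty.
  split; first exact: unstereo_sphere.
  rewrite extend_inftyE; last exact: unstereo_neq.
  by rewrite unstereoK; have [_ ->] := h1 t (stereo x) t01 I; rewrite stereoK.
move=> H; have H' := homeo_family_sym H; split.
- exact: one H.
- exact: one H'.
- exact: homeo_family_extend_cts H.
- exact: homeo_family_extend_cts H'.
Qed.

End Families.

(** * Rotations of the sphere *)

Section Rotations.
Context {R : realType}.
Implicit Types (p q m x : 'rV[R]_3) (L M N : 'M[R]_3).

Lemma orthogonal1 : orthogonal (1%:M : 'M[R]_3).
Proof. by rewrite /orthogonal trmx1 mulmx1. Qed.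

Lemma orthogonal_mul M N : orthogonal M -> orthogonal N -> orthogonal (M *m N).
Proof.
move=> oM oN; rewrite /orthogonal trmx_mul mulmxA -(mulmxA M) oN mulmx1; exact: oM.
Qed.

Lemma orthogonal_trK M : orthogonal M -> M^T *m M = 1%:M.
Proof. by move=> oM; have := orthogonal_tr oM; rewrite /orthogonal trmxK. Qed.

Definition rotation M := orthogonal M /\ \det M = 1.

Lemma rotation1 : rotation 1%:M.
Proof. by split; [exact: orthogonal1 | rewrite det1]. Qed.

Lemma rotation_mul M N : rotation M -> rotation N -> rotation (M *m N).
Proof.
move=> [oM dM] [oN dN]; split; first exact: orthogonal_mul.
by rewrite det_mulmx dM dN mulr1.
Qed.

Lemma rotation_tr M : rotation M -> rotation M^T.
Proof. by move=> [oM dM]; split; [exact: orthogonal_tr | rewrite det_tr]. Qed.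

Lemma row_mx_ext M N : (forall x, x *m M = x *m N) -> M = N.
Proof. by move=> h; apply/row_matrixP => i; rewrite !rowE h. Qed.

Definition Rz (a : R) : 'M[R]_3 :=
  \matrix_(i < 3) (if i == 0 :> nat then vec3 (cos a) (sin a) 0
    else if i == 1 :> nat then vec3 (- sin a) (cos a) 0 else vec3 0 0 1).

Lemma mulmx_Rz x a : x *m Rz a =
  vec3 (px x * cos a - py x * sin a) (px x * sin a + py x * cos a) (pz x).
Proof.
have e : forall j, (x *m Rz a) ord0 j =
    px x * vec3 (cos a) (sin a) 0 ord0 j + py x * vec3 (- sin a) (cos a) 0 ord0 j
    + pz x * vec3 0 0 1 ord0 j.
  move=> j; rewrite mxE !big_ord_recl big_ord0 addr0 addrA.
  rewrite /px /py /pz [Rz a ord0 j]mxE [Rz a (lift ord0 ord0) j]mxE.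
  rewrite (_ : lift ord0 (lift ord0 ord0) = ord_max); last exact: val_inj.
  by rewrite [Rz a ord_max j]mxE.
apply: eq_vec3; rewrite vecE.
- by rewrite /px e -!/(px _) !vecE; ring.
- by rewrite /py e -!/(py _) !vecE; ring.
- by rewrite /pz e -!/(pz _) !vecE; ring.
Qed.

Lemma Rz0 : Rz 0 = 1%:M.
Proof.
apply: row_mx_ext => x; rewrite mulmx_Rz mulmx1 cos0 sin0.
by apply: eq_vec3; rewrite vecE; ring.
Qed.

Lemma RzN a : Rz a *m Rz (- a) = 1%:M.
Proof.
apply: row_mx_ext => x; rewrite mulmx1 mulmxA !mulmx_Rz cosN sinN.
have cs := cos2Dsin2 a.
apply: eq_vec3; rewrite !vecE //.
  rewrite -[RHS]mulr1 -cs; ring.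
rewrite -[RHS]mulr1 -cs; ring.
Qed.

Lemma Rz_tr a : (Rz a)^T = Rz (- a).
Proof.
apply/matrixP; apply: ord3_ind; apply: ord3_ind; rewrite !mxE /= ?mxE /= ?cosN ?sinN ?opprK //.
Qed.

Lemma orthogonal_Rz a : orthogonal (Rz a).
Proof. by rewrite /orthogonal Rz_tr RzN. Qed.

Lemma infty_Rz a : infty R *m Rz a = infty R.
Proof. by rewrite mulmx_Rz; apply: eq_vec3; rewrite vecE !inftyE; ring. Qed.

Lemma cvg_Rz (T : Type) (F : set_system T) {FF : Filter F} (f : T -> R) a :
  f @ F --> a -> (fun t => Rz (f t)) @ F --> Rz a.
Proof.
move=> fa.
have ca : (fun t => cos (f t)) @ F --> cos a.
  exact: (@continuous_cvg _ _ _ _ _ f (@cos R) _ (@continuous_cos R a) fa).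
have sa : (fun t => sin (f t)) @ F --> sin a.
  exact: (@continuous_cvg _ _ _ _ _ f (@sin R) _ (@continuous_sin R a) fa).
have c0 (k : R) : (fun _ : T => k) @ F --> k by exact: cvg_cst.
have nsa : (fun t => - sin (f t)) @ F --> - sin a by exact: cvgN.
have row (i : 'I_3) g (v : 'rV[R]_3) j : (forall t, row i (Rz (f t)) = g t) ->
    row i (Rz a) = v -> g @ F --> v -> (fun t => Rz (f t) i j) @ F --> Rz a i j.
  move=> hg hv gv; have e b : Rz b i j = row i (Rz b) ord0 j by rewrite [RHS]mxE.
  rewrite e hv (_ : (fun t => _) = (fun t => g t ord0 j)); last first.
    by apply/funext => t; rewrite e hg.
  exact: cvg_entry.
apply: cvg_entries => i j; move: i; apply: ord3_ind.
- by apply: (row _ (fun t => vec3 (cos (f t)) (sin (f t)) 0));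
    [move=> t; exact: rowK | exact: rowK | exact: cvg_vec3].
- by apply: (row _ (fun t => vec3 (- sin (f t)) (cos (f t)) 0));
    [move=> t; exact: rowK | exact: rowK | exact: cvg_vec3].
- by apply: (row _ (fun t => vec3 0 0 1));
    [move=> t; exact: rowK | exact: rowK | exact: cvg_cst].
Qed.

Lemma det22 (A : 'M[R]_2) :
  \det A = A ord0 ord0 * A ord_max ord_max - A ord0 ord_max * A ord_max ord0.
Proof.
have l1 : lift ord0 ord0 = ord_max :> 'I_2 by exact: val_inj.
have l2 : lift ord_max ord0 = ord0 :> 'I_2 by exact: val_inj.
rewrite (expand_det_row _ ord0) !big_ord_recl big_ord0 addr0 l1.
rewrite /cofactor !det_mx11 !mxE ?l1 ?l2 /=.
rewrite ?l1 ?l2 /bump /=; ring.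
Qed.

Lemma rotation_axis M : rotation M -> infty R *m M = infty R ->
  exists a, M = Rz a.
Proof.
move=> [oM dM] fM.
have fMT : infty R *m M^T = infty R.
  by rewrite -{1}fM -mulmxA oM mulmx1.
have inE N i : (infty R *m N) ord0 i = N ord_max i.
  by rewrite /infty -rowE mxE.
have m20 : M ord_max ord0 = 0 by rewrite -inE fM -/(px _) px_infty.
have m21 : M ord_max (lift ord0 ord0) = 0 by rewrite -inE fM -/(py _) py_infty.
have m22 : M ord_max ord_max = 1 by rewrite -inE fM -/(pz _) pz_infty.
have m02 : M ord0 ord_max = 0.
  by have := inE M^T ord0; rewrite fMT -/(px _) px_infty mxE => <-.
have m12 : M (lift ord0 ord0) ord_max = 0.
  by have := inE M^T (lift ord0 ord0); rewrite fMT -/(py _) py_infty mxE => <-.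
set a := M ord0 ord0; set b := M ord0 (lift ord0 ord0).
set c := M (lift ord0 ord0) ord0; set d := M (lift ord0 ord0) (lift ord0 ord0).
have o2 : lift ord0 (lift ord0 ord0) = ord_max :> 'I_3 by exact: val_inj.
have oE i j : \sum_k M i k * M j k = (i == j)%:R.
  have := congr1 (fun N : 'M[R]_3 => N i j) oM; rewrite !mxE => <-.
  by apply: eq_bigr => k _; rewrite mxE.
have h1 : a ^+ 2 + b ^+ 2 = 1.
  have : \sum_k M ord0 k * M ord0 k = 1 by rewrite oE eqxx.
  rewrite !big_ord_recl big_ord0 o2 m02 -/a -/b => <-; ring.
have h2 : c ^+ 2 + d ^+ 2 = 1.
  have : \sum_k M (lift ord0 ord0) k * M (lift ord0 ord0) k = 1 by rewrite oE eqxx.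
  rewrite !big_ord_recl big_ord0 o2 m12 -/c -/d => <-; ring.
have h3 : a * c + b * d = 0.
  have : \sum_k M ord0 k * M (lift ord0 ord0) k = 0 by rewrite oE.
  rewrite !big_ord_recl big_ord0 o2 m02 m12 -/a -/b -/c -/d => <-; ring.
have h4 : a * d - b * c = 1.
  rewrite -dM (expand_det_row _ ord_max) !big_ord_recl big_ord0 o2 m20 m21 m22.
  rewrite !mul0r !add0r addr0 mul1r /cofactor det22 !mxE /=.
  have l0 : lift ord_max ord0 = ord0 :> 'I_3 by exact: val_inj.
  have l1 : lift ord_max ord_max = lift ord0 ord0 :> 'I_3 by exact: val_inj.
  rewrite (_ : (-1) ^+ _ = 1 :> R) ?mul1r; last by rewrite -signr_odd.
  by rewrite ?l0 ?l1 -/a -/b -/c -/d.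
have da : d = a.
  transitivity (d * (a ^+ 2 + b ^+ 2)); first by rewrite h1 mulr1.
  transitivity (a * (a * d - b * c) + b * (a * c + b * d)); first by ring.
  by rewrite h4 h3; ring.
have cb : c = - b.
  transitivity (c * (a ^+ 2 + b ^+ 2)); first by rewrite h1 mulr1.
  transitivity (a * (a * c + b * d) - b * (a * d - b * c)); first by ring.
  by rewrite h4 h3; ring.
have [t ct st] : exists2 t, cos t = a & sin t = b.
  have a11 : -1 <= a <= 1.
    by have := sqr_ge0 b; move=> b2; apply/andP; split; nra.
  have s2 : Num.sqrt (1 - a ^+ 2) = `|b| by rewrite -h1 addrC addKr sqrtr_sqr.
  have [b0|b0] := leP 0 b.
    by exists (acos a); rewrite ?acosK// sin_acos// s2 ger0_norm.
  by exists (- acos a); rewrite ?cosN ?acosK// sinN sin_acos// s2 ltr0_norm// opprK.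
exists t; apply: row_mx_ext => x; rewrite mulmx_Rz ct st.
have e j : (x *m M) ord0 j = px x * M ord0 j + py x * M (lift ord0 ord0) j + pz x * M ord_max j.
  by rewrite mxE !big_ord_recl big_ord0 addr0 addrA o2.
apply: eq_vec3; rewrite vecE.
- by rewrite /px e m20 -/a -/c cb /px; ring.
- by rewrite /py e m21 -/b -/d da /py; ring.
- by rewrite /pz e m02 m12 m22 /pz; ring.
Qed.

(** The rotation by pi about the line of m; the length of m does not matter. *)
Definition halfturn m : 'M[R]_3 := (2 / sqnorm m) *: (m^T *m m) - 1%:M.
Definition dot p q : R := (p *m q^T) ord0 ord0.

Lemma dotE p q : dot p q = px p * px q + py p * py q + pz p * pz q.
Proof.
rewrite /dot mxE !big_ord_recl big_ord0 addr0 addrA !mxE /px /py /pz.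
by rewrite (_ : lift ord0 (lift ord0 ord0) = ord_max) //; exact: val_inj.
Qed.

Lemma mulmx_halfturn p m : p *m halfturn m = (2 * dot p m / sqnorm m) *: m - p.
Proof.
rewrite /halfturn mulmxBr mulmx1 -scalemxAr mulmxA (mx11_scalar (p *m m^T)).
by rewrite mul_scalar_mx scalerA -/(dot p m); congr (_ *: _ - _); ring.
Qed.

Lemma sqnormE p : sqnorm p = dot p p.
Proof. exact: sqnorm_mx. Qed.

Lemma sphere_normalize m : m != 0 ->
  (Num.sqrt (sqnorm m))^-1 != 0 /\ @sphere R ((Num.sqrt (sqnorm m))^-1 *: m).
Proof.
move=> m0; have s0 : 0 < sqnorm m by rewrite lt0r sqnorm_eq0 m0 sqnorm_ge0.
split; first by rewrite invr_eq0 sqrtr_eq0 -ltNge.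
apply/sphereP; rewrite !pxZ !pyZ !pzZ !exprMn -!mulrDr -sqnorm3.
by rewrite exprVn sqr_sqrtr ?sqnorm_ge0// mulVf// lt0r_neq0.
Qed.

Lemma halfturn_sym m : (halfturn m)^T = halfturn m.
Proof. by rewrite /halfturn linearB linearZ /= trmx_mul trmxK trmx1. Qed.

Lemma halfturn_invol m : m != 0 -> halfturn m *m halfturn m = 1%:M.
Proof.
move=> m0; apply: row_mx_ext => x; rewrite mulmx1 mulmxA.
rewrite mulmx_halfturn (mulmx_halfturn x).
have n0 : sqnorm m != 0 by rewrite sqnorm_eq0.
set c := 2 * dot x m / sqnorm m.
have -> : dot (c *: m - x) m = dot x m.
  transitivity (c * dot m m - dot x m); first by rewrite !dotE !coordE; ring.
  by rewrite -sqnormE /c; field.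
by rewrite opprB addrCA subrr addr0.
Qed.

Lemma orthogonal_halfturn m : m != 0 -> orthogonal (halfturn m).
Proof. by move=> m0; rewrite /orthogonal halfturn_sym halfturn_invol. Qed.

Lemma halfturnZ k m : k != 0 -> halfturn (k *: m) = halfturn m.
Proof.
move=> k0; rewrite /halfturn; congr (_ - _).
have -> : sqnorm (k *: m) = k ^+ 2 * sqnorm m.
  by rewrite !sqnorm3 !coordE; ring.
have -> : (k *: m)^T = k *: m^T by apply/matrixP => i j; rewrite !mxE.
rewrite -scalemxAl -scalemxAr !scalerA; congr (_ *: _).
have [->|n0] := eqVneq (sqnorm m) 0; first by rewrite mulr0 invr0; ring.
by field; rewrite n0 k0.
Qed.

Lemma halfturn_rotate m M : orthogonal M ->
  halfturn (m *m M) = M^T *m halfturn m *m M.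
Proof.
move=> oM; rewrite /halfturn sqnorm_orthogonal// trmx_mul.
rewrite mulmxBr mulmxBl mulmx1 orthogonal_trK//; congr (_ - _).
by rewrite -scalemxAr -scalemxAl !mulmxA.
Qed.

Lemma halfturn_exchange p q : @sphere R p -> @sphere R q -> p + q != 0 ->
  p *m halfturn (p + q) = q.
Proof.
move=> /sphereP Sp /sphereP Sq pq0; rewrite mulmx_halfturn.
have n0 : sqnorm (p + q) != 0 by rewrite sqnorm_eq0.
rewrite (_ : 2 * dot p (p + q) / sqnorm (p + q) = 1); last first.
  rewrite (_ : 2 * _ = sqnorm (p + q)); first by rewrite divff.
  rewrite dotE sqnorm3 !coordE.
  transitivity (2 * (px p ^+ 2 + py p ^+ 2 + pz p ^+ 2) +
    2 * (px p * px q + py p * py q + pz p * pz q)); first by ring.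
  rewrite (_ : 2 * (_ + _ + _) = (px p ^+ 2 + py p ^+ 2 + pz p ^+ 2) +
    (px q ^+ 2 + py q ^+ 2 + pz q ^+ 2)); last by rewrite Sp Sq; ring.
  by ring.
by rewrite scale1r addrC addKr.
Qed.

Lemma halfturn_fix p : @sphere R p -> p *m halfturn p = p.
Proof.
move=> Sp; rewrite mulmx_halfturn -sqnormE; move: Sp; rewrite /sphere/= => ->.
by apply: eq_vec3; rewrite !coordE; field.
Qed.

Lemma sphere_neq0 p : @sphere R p -> p != 0.
Proof.
by rewrite /sphere/= => Sp; rewrite -sqnorm_eq0 Sp oner_neq0.
Qed.

Lemma halfturn_infty : \det (halfturn (infty R)) = 1.
Proof.
have -> : halfturn (infty R) = diag_mx (vec3 (-1) (-1) 1).
  apply: row_mx_ext => x; rewrite mulmx_halfturn.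
  have -> : sqnorm (infty R) = 1 by exact: sphere_infty.
  have -> : dot x (infty R) = pz x by rewrite dotE !inftyE; ring.
  have e j : (x *m diag_mx (vec3 (-1) (-1) 1)) ord0 j = x ord0 j * vec3 (-1) (-1) 1 ord0 j.
    by rewrite mul_mx_diag mxE.
  apply: eq_vec3; rewrite ?coordE ?inftyE.
  - by rewrite [RHS]/px e -!/(px _) vecE; field.
  - by rewrite [RHS]/py e -!/(py _) vecE; field.
  - by rewrite [RHS]/pz e -!/(pz _) vecE; field.
rewrite det_diag !big_ord_recl big_ord0 mulr1.
rewrite (_ : lift ord0 (lift ord0 ord0) = ord_max :> 'I_3); last exact: val_inj.
by rewrite -!/(px _) -!/(py _) -!/(pz _) !vecE; ring.
Qed.

Lemma halfturn_to_infty p : @sphere R p ->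
  exists2 m, @sphere R m & p *m halfturn m = infty R.
Proof.
move=> Sp; have [e|n0] := eqVneq (p + infty R) 0.
  (* p is the south pole: any horizontal axis will do. *)
  exists (vec3 1 0 0); first by apply/sphereP; rewrite !vecE; ring.
  have -> : p = - infty R by apply/eqP; rewrite -addr_eq0 e.
  rewrite mulmx_halfturn.
  have -> : dot (- infty R) (vec3 1 0 0) = 0.
    by rewrite dotE !coordE !inftyE !vecE; ring.
  by rewrite mulr0 mul0r scale0r sub0r opprK.
have [k0 Sm] := sphere_normalize n0.
exists ((Num.sqrt (sqnorm (p + infty R)))^-1 *: (p + infty R)) => //.
by rewrite halfturnZ//; apply: halfturn_exchange => //; exact: sphere_infty.
Qed.

(** A half-turn has determinant 1 because it is conjugate, by another half-turn,
    to the one about the vertical axis. *)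
Lemma rotation_halfturn m : m != 0 -> rotation (halfturn m).
Proof.
move=> m0; split; first exact: orthogonal_halfturn.
have [k0 Sm] := sphere_normalize m0.
rewrite -(halfturnZ m k0).
have [b Sb e] := halfturn_to_infty Sm.
have oB := orthogonal_halfturn (sphere_neq0 Sb).
have := halfturn_infty; rewrite -e halfturn_rotate// !det_mulmx => d.
have d2 : \det (halfturn b) * \det (halfturn b) = 1.
  by rewrite -det_mulmx halfturn_invol ?det1// sphere_neq0.
by move: d; rewrite det_tr mulrAC d2 mul1r.
Qed.

Lemma rotation_to_infty p : @sphere R p ->
  exists2 M, rotation M & p *m M = infty R.
Proof.
move=> /halfturn_to_infty[m Sm e]; exists (halfturn m) => //.
exact/rotation_halfturn/sphere_neq0.
Qed.

(** Conjugate the rotations about the vertical axis by angles from 0 to pi. *)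
Lemma halfturn_path m : @sphere R m -> exists L : R -> 'M[R]_3,
  [/\ continuous L, forall t, orthogonal (L t), L 0 = 1%:M & L 1 = halfturn m].
Proof.
move=> Sm; have [b Sb e] := halfturn_to_infty Sm.
have oB := orthogonal_halfturn (sphere_neq0 Sb).
set B := halfturn b in e oB.
exists (fun t => B *m Rz (t * pi) *m B^T); split.
- move=> t; apply: cvg_mulmx; last exact: cvg_cst.
  apply: cvg_mulmx; first exact: cvg_cst.
  by apply: cvg_Rz; apply: cvgM; [exact: cvg_id | exact: cvg_cst].
- move=> t; apply: orthogonal_mul; last exact: orthogonal_tr.
  by apply: orthogonal_mul => //; exact: orthogonal_Rz.
- by rewrite mul0r Rz0 mulmx1; exact: oB.
- have -> : m = infty R *m B^T by rewrite -e -mulmxA oB mulmx1.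
  rewrite halfturn_rotate; last exact: orthogonal_tr.
  rewrite trmxK mul1r; congr (_ *m _ *m _); apply: row_mx_ext => x.
  rewrite mulmx_Rz cospi sinpi mulmx_halfturn.
  have -> : sqnorm (infty R) = 1 by exact: sphere_infty.
  have -> : dot x (infty R) = pz x by rewrite dotE !inftyE; ring.
  by apply: eq_vec3; rewrite !coordE !vecE !inftyE; field.
Qed.

End Rotations.

(** * Lifting a path on the sphere to rotations *)

Lemma continuous_clamp {R : realType} (a b : R) :
  continuous (fun t : R => Num.max a (Num.min t b)).
Proof.
have mn : continuous (fun t : R => Num.min t b).
  under eq_fun do rewrite minr_absE.
  move=> t; apply: cvgM; last exact: cvg_cst.
  apply: cvgB; first by apply: cvgD; [exact: cvg_id | exact: cvg_cst].
  by apply: cvg_norm; apply: cvgB; [exact: cvg_id | exact: cvg_cst].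
move=> t; under eq_fun do rewrite maxr_absE.
rewrite /continuous_at ?maxr_absE; apply: cvgM; last exact: cvg_cst.
apply: cvgD; first by apply: cvgD; [exact: cvg_cst | exact: mn].
by apply: cvg_norm; apply: cvgB; [exact: cvg_cst | exact: mn].
Qed.

Section Lift.
Context {R : realType}.
Variable g : R -> 'rV[R]_3.
Hypothesis gc : continuous g.
Hypothesis gS : forall t, @sphere R (g t).

(* The parameters of antipodal points form a compact set off the diagonal. *)
Let not_antipodal : exists2 d : R, 0 < d &
  forall s t, 0 <= s <= 1 -> 0 <= t <= 1 -> `|s - t| < d -> g s + g t != 0.
Proof.
pose K := (`[0, 1] `*` `[0, 1]) `&` [set z : R * R | g z.1 + g z.2 = 0].
have gg : continuous (fun z : R * R => g z.1 + g z.2).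
  move=> z; apply: cvgD.
    apply: (@continuous_cvg _ _ _ _ _ fst g); [exact: gc | exact: cvg_fst].
  apply: (@continuous_cvg _ _ _ _ _ snd g); [exact: gc | exact: cvg_snd].
have cK : compact K.
  apply: compact_closedI; first by apply: compact_setX; exact: segment_compact.
  rewrite (_ : mkset _ = (fun z : R * R => g z.1 + g z.2) @^-1` [set 0])//.
  apply: preimage_closed; first by move=> z _; exact: gg.
  by apply: compact_closed; [exact: norm_hausdorff | exact: compact_set1].
have [K0|/set0P K0] := eqVneq K set0.
  exists 1 => // s t s01 t01 _; apply/eqP => e.
  by have : K (s, t) by []; rewrite K0.
have [|z] := @compact_EVT_min _ R (fun z : R * R => `|z.1 - z.2|) K K0 cK.
  apply: continuous_subspaceT => z; apply: cvg_norm; apply: cvgB; [exact: cvg_fst|exact: cvg_snd].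
rewrite inE => -[_ z0] hz.
exists (`|z.1 - z.2|).
  rewrite normr_gt0 subr_eq0; apply/eqP => e; move: z0; rewrite /= e.
  rewrite -mulr2n -scaler_nat => /eqP; rewrite scaler_eq0 pnatr_eq0 /= => h.
  by have := sphere_neq0 (gS z.2); rewrite h.
move=> s t s01 t01; rewrite ltNge; apply: contra => /eqP e.
by apply: (hz (s, t)); rewrite inE.
Qed.

Lemma cvg_halfturn (T : Type) (F : set_system T) {FF : Filter F}
    (f : T -> 'rV[R]_3) (m : 'rV[R]_3) :
  m != 0 -> f @ F --> m -> (fun t => halfturn (f t)) @ F --> halfturn m.
Proof.
move=> m0 fm; rewrite /halfturn; apply: cvgB; last exact: cvg_cst.
apply: cvgZ; last by apply: cvg_mulmx => //; apply: cvg_trmx.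
apply: cvgM; first exact: cvg_cst.
by apply: cvgV; [rewrite sqnorm_eq0 | exact: cvg_sqnorm].
Qed.

(** Path lifting for the map M |-> g 0 *m M^T from rotations to the sphere.  Cut
    [0, 1] into pieces [s n, s n.+1] so short that g never meets antipodal points
    on a piece.  The half-turn about g t followed by the one about g t + g (s n)
    carries g t to g (s n), depends continuously on t, and is the identity when
    g t = g (s n).  With t clamped to the piece this is a factor M defined for all
    t, constant after the piece and trivial before it, and L is the product of
    these factors. *)
Lemma rotation_lift : exists L : R -> 'M[R]_3,
  [/\ continuous L, forall t, rotation (L t), L 0 = 1%:M &
      forall t, 0 <= t <= 1 -> g t *m L t = g 0].
Proof.
have [d d0 hd] := not_antipodal.
pose N := (Num.truncn d^-1).+1.
have Nd : N%:R^-1 < d.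
  by rewrite invf_plt ?posrE ?ltr0n//; exact: Num.Theory.truncnS_gt.
have N0 : 0 < N%:R :> R by rewrite ltr0n.
pose s n : R := n%:R / N%:R.
pose c n t := Num.max (s n) (Num.min t (s n.+1)).
have ss n : s n < s n.+1 by rewrite /s ltr_pM2r ?invr_gt0// ltr_nat.
have s0 n : 0 <= s n by rewrite divr_ge0// ler0n.
have s1 n : (n <= N)%N -> s n <= 1 by move=> nN; rewrite /s ler_pdivrMr// mul1r ler_nat.
have sS n : s n.+1 = s n + N%:R^-1 by rewrite /s -addn1 natrD mulrDl mul1r.
have cn n t : s n <= c n t <= s n.+1.
  by rewrite /c le_max lexx/= ge_max (ltW (ss n)) ge_min lexx orbT.
have cc n : continuous (c n).
  exact: continuous_clamp.
have na n t : (n < N)%N -> g (c n t) + g (s n) != 0.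
  move=> nN; have /andP[h1 h2] := cn n t; apply: hd.
  - by rewrite (le_trans (s0 n) h1) (le_trans h2)// s1.
  - by rewrite s0 s1// ltnW.
  - rewrite ger0_norm ?subr_ge0//; apply: le_lt_trans Nd.
    by rewrite lerBlDr addrC -sS.
have H n : (n <= N)%N -> exists L : R -> 'M[R]_3,
    [/\ continuous L, forall t, rotation (L t), L 0 = 1%:M &
      forall t, 0 <= t -> g (Num.min t (s n)) *m L t = g 0].
  elim: n => [_|n IH nN].
    exists (fun=> 1%:M); split => //.
    - by move=> t; exact: cvg_cst.
    - by move=> t; exact: rotation1.
    - move=> t t0; rewrite mulmx1 (_ : Num.min t (s 0%N) = 0)//.
      by rewrite /s mul0r; apply/min_idPr.
  have [L [Lc Lr L0 Lg]] := IH (ltnW nN).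
  pose M t := halfturn (g (c n t)) *m halfturn (g (c n t) + g (s n)).
  have Mg t : g (c n t) *m M t = g (s n).
    by rewrite /M mulmxA halfturn_fix// halfturn_exchange// na.
  have M1 t : c n t = s n -> M t = 1%:M.
    move=> e; rewrite /M e -mulr2n -scaler_nat halfturnZ ?pnatr_eq0//.
    by rewrite halfturn_invol// sphere_neq0.
  exists (fun t => M t *m L t); split.
  - move=> t; apply: cvg_mulmx; last exact: Lc.
    have gct : g (c n x) @[x --> t] --> g (c n t).
      by apply: (@continuous_cvg _ _ _ _ _ (c n) g); [exact: gc | exact: cc].
    apply: cvg_mulmx; apply: cvg_halfturn; rewrite ?na// ?sphere_neq0//.
    by apply: cvgD => //; exact: cvg_cst.
  - move=> t; apply: rotation_mul => //; apply: rotation_mul;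
      apply: rotation_halfturn; rewrite ?na// sphere_neq0//.
  - rewrite L0 mulmx1 M1// /c; apply/max_idPl.
    by rewrite ge_min s0.
  - move=> t t0; have [tn|nt] := leP t (s n).
      rewrite M1; last by rewrite /c; apply/max_idPl; rewrite ge_min tn.
      rewrite mul1mx (_ : Num.min t (s n.+1) = Num.min t (s n)); first exact: Lg.
      by rewrite !min_l// (le_trans tn (ltW (ss n))).
    have -> : Num.min t (s n.+1) = c n t.
      by rewrite /c max_r// le_min (ltW nt) (ltW (ss n)).
    rewrite mulmxA Mg -(Lg t t0); congr (g _ *m _).
    by rewrite min_r// ltW.
have [L [Lc Lr L0 Lg]] := H N (leqnn N); exists L; split => // t /andP[t0 t1].
rewrite -(Lg t t0) (_ : Num.min _ _ = t)//; apply/min_idPl.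
by rewrite /s divff ?lt0r_neq0.
Qed.

End Lift.

(** * Pushing a point around in the complement of a set *)

Section Push.
Context {R : realType}.
Implicit Types (p q : 'rV[R]_3).

Lemma isotopy_comp (V : normedModType R) (A : set V) (h k : R -> V -> V) :
  isotopy A h -> isotopy A k -> isotopy A (fun t x => k t (h t x)).
Proof.
move=> [h0 [g fh]] [k0 [l fk]]; split.
  by move=> x Ax; rewrite h0// k0.
by exists (fun t y => g t (l t y)); apply: homeo_family_comp fh fk.
Qed.

Lemma isotopy_rotation (L : R -> 'M[R]_3) : continuous L ->
  (forall t, orthogonal (L t)) -> L 0 = 1%:M ->
  isotopy (@sphere R) (fun t x => x *m L t).
Proof.
move=> cL oL L0; split; first by move=> x _; rewrite L0 mulmx1.
by exists (fun t x => x *m (L t)^T); apply: homeo_family_rotation.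
Qed.

Lemma isotopy_id (V : normedModType R) (A : set V) : isotopy A (fun _ x => x).
Proof.
split => //; exists (fun _ x => x).
have c : {within `[0, 1] `*` A, continuous (fun z : R * V => z.2)}.
  apply/(within2P _ (fun _ x => x)) => t x _ _.
  exact: (@cvg_within_snd _ _ _ (_, _)).
by split.
Qed.

Lemma pz_Rz (x : 'rV[R]_3) a : pz (x *m Rz a) = pz x.
Proof. by rewrite mulmx_Rz vecE. Qed.

(** A twist turns each parallel of the sphere by an angle that depends on its
    height; it preserves the height, so that its inverse is explicit. *)
Lemma homeo_family_twist (f : R -> R) : continuous f ->
  homeo_family (@sphere R) (@sphere R) (fun t x => x *m Rz (t * f (pz x)))
    (fun t x => x *m Rz (- (t * f (pz x)))).
Proof.
move=> cf.
have S (x : 'rV[R]_3) b : @sphere R x -> @sphere R (x *m Rz b).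
  by apply: sphere_orthogonal; exact: orthogonal_Rz.
have ang (t : R) (x : 'rV[R]_3) :
    (fun z : R * 'rV[R]_3 => z.1 * f (pz z.2)) @ within (`[0, 1] `*` @sphere R) (nbhs (t, x))
    --> t * f (pz x).
  apply: cvgM.
    exact: (@cvg_within_fst _ _ _ (_, _)).
  have zc : (fun z : R * 'rV[R]_3 => pz z.2) @ within (`[0, 1] `*` @sphere R) (nbhs (t, x)) --> pz x.
    by apply: cvg_pz; exact: (@cvg_within_snd _ _ _ (_, _)).
  exact: (cvg_comp _ _ zc (cf _)).
have sndc (t : R) (x : 'rV[R]_3) : (fun z : R * 'rV[R]_3 => z.2)
    @ within (`[0, 1] `*` @sphere R) (nbhs (t, x)) --> x.
  exact: (@cvg_within_snd _ _ _ (_, _)).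
split.
- move=> t x _ Sx; split; first exact: S.
  by rewrite pz_Rz -mulmxA RzN mulmx1.
- move=> t x _ Sx; split; first exact: S.
  by rewrite pz_Rz -mulmxA -[X in _ *m Rz X]opprK RzN mulmx1.
- apply/(within2P _ (fun t x => x *m Rz (t * f (pz x)))) => t x _ _.
  by apply: cvg_mulmx => //; apply: cvg_Rz.
- apply/(within2P _ (fun t x => x *m Rz (- (t * f (pz x))))) => t x _ _.
  by apply: cvg_mulmx => //; apply: cvg_Rz; apply: cvgN.
Qed.

Lemma isotopy_twist (f : R -> R) (B : 'M[R]_3) : continuous f -> orthogonal B ->
  isotopy (@sphere R) (fun t x => (x *m B) *m Rz (t * f (pz (x *m B))) *m B^T).
Proof.
move=> cf oB; split.
  by move=> x _; rewrite mul0r Rz0 mulmx1 mulmx_orthogonalK.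
have HB : homeo_family (@sphere R) (@sphere R) (fun _ x => x *m B) (fun _ x => x *m B^T).
  by apply: (homeo_family_rotation (L := fun=> B)) => //; exact: cst_continuous.
have H := homeo_family_comp (homeo_family_comp HB (homeo_family_twist cf)) (homeo_family_sym HB).
by eexists; exact: H.
Qed.

Definition push (G : set 'rV[R]_3) q p := exists2 h, isotopy (@sphere R) h &
  h 1 q = p /\ forall x, @sphere R x -> G x -> h 1 x = x.

(** Close points q and p have the same height over their midpoint direction a.
    The twist about a which is a half-turn at this height and above, and fades to
    the identity just below it, exchanges them and moves only points near q. *)
Lemma push_near q (U : set 'rV[R]_3) : @sphere R q -> nbhs q U ->
  \forall p \near q, @sphere R p -> push (~` U) q p.
Proof.
move=> Sq /nbhs_sqnorm[e e0 hU].
pose d := Num.min (e / 8) 2.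
have d0 : 0 < d by rewrite lt_min divr_gt0/=.
apply: filterS (near_sqnorm q d0) => p pd Sp.
have [pd1 pd2] : sqnorm (p - q) < e / 8 /\ sqnorm (p - q) < 2.
  by move: pd; rewrite /d lt_min => /andP[].
have /sphereP Sq' := Sq; have /sphereP Sp' := Sp.
have sub (x y : 'rV[R]_3) : sqnorm (x - y) = sqnorm x + sqnorm y - 2 * dot x y.
  by rewrite !sqnorm3 dotE !coordE; ring.
have add (x y : 'rV[R]_3) : sqnorm (x + y) = sqnorm x + sqnorm y + 2 * dot x y.
  by rewrite !sqnorm3 dotE !coordE; ring.
have Sq1 : sqnorm q = 1 := Sq; have Sp1 : sqnorm p = 1 := Sp.
set n := Num.sqrt (sqnorm (p + q)).
have n2 : n ^+ 2 = 4 - sqnorm (p - q).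
  by rewrite sqr_sqrtr ?sqnorm_ge0// add sub Sq1 Sp1; ring.
have n0 : 0 < n.
  by rewrite sqrtr_gt0 add Sq1 Sp1; move: pd2; rewrite sub Sq1 Sp1; lra.
have nle2 : n <= 2.
  rewrite -(ler_pXn2r (n := 2)) ?nnegrE// ?(ltW n0)// n2.
  by have := sqnorm_ge0 (p - q); rewrite expr2; lra.
set a := n^-1 *: (p + q).
have [_ Sa] : n^-1 != 0 /\ @sphere R a.
  apply: sphere_normalize; apply/eqP => pq0; have := n0.
  by rewrite /n (eqP (_ : sqnorm (p + q) == 0)) ?sqrtr0 ?ltxx// sqnorm_eq0 pq0.
have [B [oB dB] aB] := rotation_to_infty Sa.
have pqB : p *m B + q *m B = n *: infty R.
  by rewrite -aB -mulmxDl scalemxAl /a scalerA divff ?scale1r// lt0r_neq0.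
have heightE (x : 'rV[R]_3) : pz (x *m B) = dot x a.
  have -> : a = infty R *m B^T by rewrite -aB -mulmxA oB mulmx1.
  rewrite /dot trmx_mul trmxK mulmxA -/(dot _ _) dotE !inftyE; ring.
have dqa : dot q a = n / 2.
  rewrite (_ : dot q a = n^-1 * (dot q p + dot q q)); last by rewrite !dotE !coordE; ring.
  rewrite -sqnormE Sq1 (_ : dot q p + 1 = n ^+ 2 / 2); last first.
    by rewrite n2 sub Sq1 Sp1 !dotE; field.
  by field; rewrite lt0r_neq0.
have zq : pz (q *m B) = n / 2 by rewrite heightE.
have zp : pz (p *m B) = n / 2.
  have := congr1 pz pqB; rewrite pzD pzZ pz_infty zq; lra.
(* Points x whose height over a exceeds z1 satisfy sqnorm (x - q) < e. *)
pose z0 := n / 2; pose z1 := 1 - e / 32.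
have z10 : z1 < z0.
  have h : (n / 2) ^+ 2 <= n / 2 by rewrite expr2 ger_pMr ?divr_gt0//; lra.
  apply: lt_le_trans h; rewrite /z1 exprMn n2; rewrite exprVn; lra.
have zz : 0 < z0 - z1 by rewrite subr_gt0.
pose f z := pi * Num.max 0 (Num.min ((z - z1) / (z0 - z1)) 1).
have cf : continuous f.
  move=> z; apply: cvgM; first exact: cvg_cst.
  apply: (@continuous_cvg _ _ _ _ _ (fun z => (z - z1) / (z0 - z1)) (fun t => Num.max 0 (Num.min t 1))).
    exact: continuous_clamp.
  by apply: cvgM; [apply: cvgB; [exact: cvg_id | exact: cvg_cst] | exact: cvg_cst].
have f0 z : z <= z1 -> f z = 0.
  move=> zle; rewrite /f max_l ?mulr0// ge_min; apply/orP; left.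
  by rewrite pmulr_lle0 ?invr_gt0// subr_le0.
have f1 : f z0 = pi.
  by rewrite /f divff ?lt0r_neq0// minxx max_r ?ler01// mulr1.
exists (fun t x => (x *m B) *m Rz (t * f (pz (x *m B))) *m B^T).
  exact: isotopy_twist.
split.
  rewrite zq f1 mul1r (_ : q *m B *m Rz pi = p *m B); first by rewrite mulmx_orthogonalK.
  have hx := congr1 px pqB; have hy := congr1 py pqB.
  rewrite pxD pxZ px_infty mulr0 in hx; rewrite pyD pyZ py_infty mulr0 in hy.
  rewrite mulmx_Rz cospi sinpi; apply: eq_vec3; rewrite vecE ?zp ?zq//; lra.
move=> x Sx Ux; rewrite f0 ?mulr0 ?Rz0 ?mulmx1 ?mulmx_orthogonalK//.
rewrite leNgt; apply/negP => xz; apply: Ux; apply: hU.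
rewrite heightE in xz.
have Sx1 : sqnorm x = 1 := Sx; have Sa1 : sqnorm a = 1 := Sa.
have h1 : sqnorm (x - a) < e / 16 by rewrite sub Sx1 Sa1; rewrite /z1 in xz; lra.
have h2 : sqnorm (q - a) < e / 16.
  by rewrite sub Sq1 Sa1 dqa; rewrite /z1 /z0 in z10; lra.
have parallelogram (u v : 'rV[R]_3) : sqnorm (u - v) <= 2 * sqnorm u + 2 * sqnorm v.
  have := sqnorm_ge0 (u + v); rewrite add sub; lra.
have := parallelogram (x - a) (q - a).
rewrite (_ : x - a - (q - a) = x - q); first lra.
by rewrite opprB addrA subrK.
Qed.

Lemma push_refl G q : push G q q.
Proof. by exists (fun _ x => x); first exact: isotopy_id. Qed.

Lemma push_sym G q p : @sphere R q -> push G q p -> push G p q.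
Proof.
move=> Sq [h [h0 [g [h1 g1 hc gc]]] [hq hG]].
have i0 : 0 <= (0 : R) <= 1 by rewrite lexx ler01.
have i1 : 0 <= (1 : R) <= 1 by rewrite lexx ler01.
exists g; first split.
- by move=> x Sx; rewrite -{1}(h0 x Sx); have [_] := h1 0 x i0 Sx.
- by exists h.
- split; first by rewrite -hq; have [_] := h1 1 q i1 Sq.
  by move=> x Sx Gx; rewrite -{1}(hG x Sx Gx); have [_] := h1 1 x i1 Sx.
Qed.

Lemma push_trans G q p r : push G q p -> push G p r -> push G q r.
Proof.
move=> [h ih [hq hG]] [k ik [kp kG]]; exists (fun t x => k t (h t x)).
  exact: isotopy_comp.
by split; [rewrite hq | move=> x Sx Gx; rewrite hG// kG].
Qed.

(** Being pushed off G to p is a locally constant property of p. *)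
Lemma push_component G q p : closed G ->
  connected_component (@sphere R `\` G) q p -> push G q p.
Proof.
move=> cG; set A := _ `\` _; set C := connected_component A q => Cp.
have Aq : A q.
  by apply: contrapT => nA; move: Cp; rewrite /C connected_component_out.
have near_push x : A x -> \forall y \near x, A y -> push G x y.
  move=> [Sx Gx].
  have nU : nbhs x (~` G).
    by apply: open_nbhs_nbhs; split => //; exact: closed_openC.
  apply: filterS (push_near Sx nU) => y H [Sy _].
  by have := H Sy; rewrite setCK.
have CA x : C x -> A x := @connected_component_sub _ A q x.
apply: (connected_locally_constant (C := C) (P := push G q) (x := q)) Cp.
- exact: component_connected.
- exact: connected_component_refl.
- exact: push_refl.
- move=> x /CA Ax qx; apply: filterS (near_push x Ax) => y H /CA Ay.
  exact: push_trans qx (H Ay).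
- move=> x /CA Ax nqx; apply: filterS (near_push x Ax) => y H /CA Ay qy.
  apply: nqx; apply: (push_trans qy); apply: push_sym (H Ay).
  by case: Ax.
Qed.

End Push.

(** * The region of the leg on the sphere *)

Section LegRegion.
Context {R : realType}.
Implicit Types (E : diagram 'rV[R]_3) (D : diagram 'rV[R]_2).

Definition off_graph E : set 'rV[R]_3 := @sphere R `\` graph E.

Definition leg_region E p : Prop :=
  off_graph E p /\ closure (connected_component (off_graph E) p) (leg E).

Lemma graph_compact (V : normedModType R) (Sigma : set V) (D : diagram V) :
  knotoid_diagram Sigma D -> compact (graph D).
Proof.
move=> KD; apply: continuous_compact; last exact: segment_compact.
apply: continuous_in_subspaceT => u; rewrite inE /= in_itv/= => u01.
exact/derivable1_continuous/C1at_derivable/(diagram_C1 KD).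
Qed.

Lemma graph_closed (V : normedModType R) (Sigma : set V) (D : diagram V) :
  knotoid_diagram Sigma D -> closed (graph D).
Proof. by move=> /graph_compact; apply: compact_closed; exact: norm_hausdorff. Qed.

Lemma leg_graph (V : normedModType R) (D : diagram V) : graph D (leg D).
Proof. by exists 0 => //=; rewrite in_itv/= lexx ler01. Qed.

Lemma graph_stereo E p : spherical_diagram E -> @sphere R p -> p <> infty R ->
  graph (stereo_diagram E) (stereo p) <-> graph E p.
Proof.
move=> [KE Ei] Sp pI; split=> -[u u01 e]; exists u => //=; last by rewrite e.
have u01' : 0 <= u <= 1 by rewrite /= in_itv in u01.
rewrite -(stereoK Sp pI) -e /= stereoK//; first exact: (diagram_in KE).
by move: Ei; apply: contra_not => h; exists u.
Qed.

Lemma graph_unstereo D w : graph (map_diagram unstereo D) (unstereo w) <-> graph D w.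
Proof.
split=> -[u u01 e]; exists u => //=; last by rewrite e.
exact: (can_inj unstereoK).
Qed.

Lemma leg_sphere E : spherical_diagram E -> @sphere R (leg E) /\ leg E <> infty R.
Proof.
move=> [KE Ei]; split; first by apply: (diagram_in KE); rewrite lexx ler01.
by move=> e; apply: Ei; rewrite -e; exact: leg_graph.
Qed.

Lemma sphere_leg_approach E W : spherical_diagram E -> nbhs (leg E) W ->
  exists x, W x /\ off_graph E x.
Proof.
move=> SE nW; have [Sl lI] := leg_sphere SE.
have PD := planar_stereo SE.
have nW' : nbhs (leg (stereo_diagram E)) (unstereo @^-1` W).
  by apply: continuous_unstereo; rewrite stereoK.
have [w [Ww [_ Gw]]] := leg_approach PD nW'.
exists (unstereo w); split => //; split; first exact: unstereo_sphere.
move=> /(graph_stereo SE (unstereo_sphere w) (@unstereo_neq _ w)).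
by rewrite unstereoK.
Qed.

Lemma unstereo_component E w v : spherical_diagram E ->
  connected_component (@plane R `\` graph (stereo_diagram E)) w v ->
  connected_component (off_graph E) (unstereo w) (unstereo v).
Proof.
move=> SE; apply: (component_image (S := @plane R)).
- by move=> x [].
- by apply: continuous_subspaceT; exact: continuous_unstereo.
- move=> x [_ Gx]; split; first exact: unstereo_sphere.
  move=> /(graph_stereo SE (unstereo_sphere x) (@unstereo_neq _ x)).
  by rewrite unstereoK.
Qed.

Lemma sphere_leg_connected E : spherical_diagram E ->
  exists N z, nbhs (leg E) N /\
    forall x, N x -> off_graph E x -> connected_component (off_graph E) z x.
Proof.
move=> SE; have [Sl lI] := leg_sphere SE.
have [N [z [nN Nz]]] := leg_connected (planar_stereo SE).
exists [set x | x <> infty R /\ N (stereo x)], (unstereo z); split.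
  exact: near_stereo.
move=> x [xI Nx] [Sx Gx]; rewrite -(stereoK Sx xI).
apply: unstereo_component => //; apply: Nz => //.
by move=> /(graph_stereo SE Sx xI).
Qed.

(** This makes it possible to choose a point of the leg region off the disc of a
    move. *)
Lemma near_leg_region E : spherical_diagram E ->
  \forall p \near leg E, off_graph E p -> leg_region E p.
Proof.
move=> SE; have [N [z [nN Nz]]] := sphere_leg_connected SE.
apply: (filterS _ nN) => p Np Op; split => // W nW.
have [x [[Nx Wx] Ox]] := sphere_leg_approach SE (filterI nN nW).
exists x; split => //; apply: (connected_component_trans (y := z)).
  by apply: connected_component_sym; exact: Nz.
exact: Nz.
Qed.

Lemma leg_region_unique E p q : spherical_diagram E ->
  leg_region E p -> leg_region E q -> connected_component (off_graph E) p q.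
Proof.
move=> SE [Op lp] [Oq lq]; have [N [z [nN Nz]]] := sphere_leg_connected SE.
have [x [px Nx]] := lp _ nN; have [y [qy Ny]] := lq _ nN.
have zx := Nz x Nx (connected_component_sub px).
have zy := Nz y Ny (connected_component_sub qy).
apply: (connected_component_trans px).
apply: (connected_component_trans (connected_component_sym zx)).
apply: (connected_component_trans zy); exact: connected_component_sym.
Qed.

Lemma leg_region_map E E' (f : 'rV[R]_3 -> 'rV[R]_3) p :
  @sphere R (leg E) ->
  {within @sphere R, continuous f} ->
  (forall x, off_graph E x -> off_graph E' (f x)) -> f (leg E) = leg E' ->
  leg_region E p -> leg_region E' (f p).
Proof.
move=> Sl fc fO fl [Op cp]; split; first exact: fO.
rewrite -fl; apply: (closure_image Sl _ fc _ cp).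
  by move=> x /connected_component_sub[].
by move=> x; apply: (component_image _ fc fO) => y [].
Qed.

Definition rotate (M : 'M[R]_3) E := map_diagram (mulmxr M) E.

Lemma off_graph_rotate M E x : orthogonal M -> off_graph E x -> off_graph (rotate M E) (x *m M).
Proof.
move=> oM [Sx Gx]; split; first exact: sphere_orthogonal.
move=> [u u01 /= e]; apply: Gx; exists u => //.
exact: (can_inj (mulmx_orthogonalK oM)).
Qed.

Lemma rotate_region M E p : orthogonal M -> spherical_diagram E ->
  leg_region E p -> leg_region (rotate M E) (p *m M).
Proof.
move=> oM SE; apply: (leg_region_map (f := fun x => x *m M)).
- by have [] := leg_sphere SE.
- exact/continuous_subspaceT/continuous_mulmxr.
- by move=> x; exact: off_graph_rotate.
- by [].
Qed.

Lemma spherical_rotate M E p : orthogonal M -> spherical_diagram E ->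
  off_graph E p -> p *m M = infty R -> spherical_diagram (rotate M E).
Proof.
move=> oM SE Op pM; split; first by apply: knotoid_rotate => //; case: SE.
by rewrite -pM; have [] := off_graph_rotate oM Op.
Qed.

Lemma leg_region_ex E : spherical_diagram E -> exists p M,
  [/\ leg_region E p, rotation M & p *m M = infty R].
Proof.
move=> SE; have [p [H Op]] := sphere_leg_approach SE (near_leg_region SE).
have [M rM pM] := rotation_to_infty Op.1.
by exists p, M; split => //; exact: H.
Qed.

Lemma normalP E : spherical_diagram E -> normal E <-> leg_region E (infty R).
Proof.
by move=> [_ Ei]; split=> [nE|[]//]; split => //; split => //; exact: sphere_infty.
Qed.

End LegRegion.

(** * From equivalence on the sphere to equivalence in the plane *)

Section Planarize.
Context {R : realType}.
Implicit Types (E : diagram 'rV[R]_3) (D : diagram 'rV[R]_2).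

Lemma isotopy_at (V : normedModType R) (A : set V) h (t : R) : isotopy A h ->
  0 <= t <= 1 -> {within A, continuous (h t)}.
Proof.
move=> [_ [g [_ _ /within2P hc _]]] t01; apply/subspace_continuousP => x Ax.
have H1 y : A y -> (`[0, 1] `*` A) (t, y) by move=> Ay; split => //=; rewrite in_itv.
have H2 : (fun y : V => (t, y)) @ within A (nbhs x) --> (t, x).
  have H21 : (fun y : V => t) @ within A (nbhs x) --> t by exact: cvg_cst.
  have H22 : (fun y : V => y) @ within A (nbhs x) --> x by exact: cvg_within.
  exact: (cvg_pair H21 H22).
exact: (within_comp H1 H2 (hc t x t01 Ax)).
Qed.

Lemma isotopy_trajectory (V : normedModType R) (A : set V) h p : isotopy A h -> A p ->
  continuous (fun t : R => h (Num.max 0 (Num.min t 1)) p).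
Proof.
move=> [_ [g [_ _ /within2P hc _]]] Ap t; set c := fun t : R => Num.max 0 (Num.min t 1).
have c01 s : 0 <= c s <= 1 by rewrite /c le_max lexx ge_max ler01 ge_min lexx orbT.
have H1 (s : R) : setT s -> (`[0, 1] `*` A) (c s, p).
  by move=> _; split => //=; rewrite in_itv/= c01.
have H2 : (fun s : R => (c s, p)) @ within setT (nbhs t) --> (c t, p).
  have H21 : c @ within setT (nbhs t) --> c t.
    by apply: (cvg_trans (cvg_app _ (cvg_within _))); exact: continuous_clamp.
  have H22 : (fun s : R => p) @ within setT (nbhs t) --> p by exact: cvg_cst.
  exact: (cvg_pair H21 H22).
have := within_comp H1 H2 (hc (c t) p (c01 t) Ap).
move=> + B nB => /(_ B nB) nB'.
have : nbhs t [set y | setT y -> B (h (c y) p)] := nB'.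
by apply: filterS => y; apply.
Qed.

(** The isotopy takes p into the leg region of E', from where it can be pushed to
    p' without moving E'. *)
Lemma carries_pushed E E' h p p' : spherical_diagram E -> spherical_diagram E' ->
  isotopy (@sphere R) h -> carries h E E' -> leg_region E p -> leg_region E' p' ->
  exists2 H, isotopy (@sphere R) H & carries H E E' /\ H 1 p = p'.
Proof.
move=> SE SE' ih [hE hov] lp lp'.
have i1 : 0 <= (1 : R) <= 1 by rewrite lexx ler01.
have KE := SE.1; have KE' := SE'.1.
have lq : leg_region E' (h 1 p).
  apply: (leg_region_map (E := E)) => //.
  - by have [] := leg_sphere SE.
  - exact: isotopy_at.
  - move=> x [Sx Gx]; have [_ [g [h1 g1 _ _]]] := ih; split; first by have [] := h1 1 x i1 Sx.
    move=> [u u01 e]; have u01' : 0 <= u <= 1 by rewrite /= in_itv in u01.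
    apply: Gx; exists u => //.
    have [_ <-] := h1 1 x i1 Sx; rewrite -e hE//.
    by have [_ ->] := h1 1 _ i1 (diagram_in KE u01').
  - by rewrite /leg hE// lexx ler01.
have [k ik [kp kG]] := push_component (graph_closed KE') (leg_region_unique SE' lq lp').
exists (fun t x => k t (h t x)); first exact: isotopy_comp.
split => //; split => // u u01; rewrite -hE// kG//; first exact: (diagram_in KE').
by exists u => //=; rewrite in_itv.
Qed.

(** Send p and p' to the north pole by rotations M and M' and project: the two
    planar diagrams are related by an isotopy of the plane, whatever h does to
    the north pole.  After [carries_pushed] the isotopy moves p
    along a path that ends at p'.  Following it by rotations L t that bring this
    path back to p keeps p fixed, so that after conjugation with M the north pole
    is fixed and the isotopy descends to the plane.  Its end differs from the
    desired one by a rotation Rz a about the vertical axis, which is undone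
    gradually by Rz (- (t * a)). *)
Lemma isotopy_planar E E' h p p' M M' :
  spherical_diagram E -> spherical_diagram E' ->
  isotopy (@sphere R) h -> carries h E E' -> leg_region E p -> leg_region E' p' ->
  rotation M -> rotation M' -> p *m M = infty R -> p' *m M' = infty R ->
  planar_equiv (stereo_diagram (rotate M E)) (stereo_diagram (rotate M' E')).
Proof.
move=> SE SE' ih cE lp lp' rM rM' pM pM'.
have [H iH [[HE Hov] Hp]] := carries_pushed SE SE' ih cE lp lp'.
have [Sp Gp] := lp.1; have [oM dM] := rM; have [oM' dM'] := rM'.
have i0 : 0 <= (0 : R) <= 1 by rewrite lexx ler01.
have i1 : 0 <= (1 : R) <= 1 by rewrite lexx ler01.
pose c (t : R) := Num.max 0 (Num.min t 1).
have c01 s : 0 <= c s <= 1 by rewrite /c le_max lexx ge_max ler01 ge_min lexx orbT.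
have cE' t : 0 <= t <= 1 -> c t = t.
  by move=> /andP[t0 t1]; rewrite /c min_l// max_r.
have [H0 [G HG]] := iH.
have [H1 _ _ _] := HG.
have [L [Lc Lr L0 Lg]] := rotation_lift (isotopy_trajectory iH Sp)
  (fun t => (H1 (c t) p (c01 t) Sp).1).
have Lp t : 0 <= t <= 1 -> H t p *m L t = p.
  by move=> t01; have := Lg t t01; rewrite -/(c t) -/(c 0) !cE'// H0.
have [a aE] : exists a, M'^T *m L 1 *m M = Rz a.
  apply: rotation_axis.
    by apply: rotation_mul => //; apply: rotation_mul => //; exact: rotation_tr.
  rewrite -{1}pM' -Hp !mulmxA -(mulmxA _ M') oM' mulmx1.
  by rewrite Lp.
pose L' t := L t *m M *m Rz (- (t * a)).
have L'c : continuous L'.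
  move=> t; apply: cvg_mulmx; last first.
    by apply: cvg_Rz; apply: cvgN; apply: cvgM; [exact: cvg_id | exact: cvg_cst].
  by apply: cvg_mulmx; [exact: Lc | exact: cvg_cst].
have L'o t : orthogonal (L' t).
  by apply: orthogonal_mul; [apply: orthogonal_mul => //; case: (Lr t) | exact: orthogonal_Rz].
have L'1 : L' 1 = M'.
  rewrite /L' mul1r (_ : L 1 *m M = M' *m Rz a) -?mulmxA ?RzN ?mulmx1//.
  by rewrite -aE !mulmxA oM' mul1mx.
have HM : homeo_family (@sphere R) (@sphere R) (fun _ x => x *m M) (fun _ x => x *m M^T).
  by apply: (homeo_family_rotation (L := fun=> M)) => //; exact: cst_continuous.
have F := homeo_family_comp (homeo_family_comp (homeo_family_sym HM) HG)
  (homeo_family_rotation L'c L'o).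
have pI : p = infty R *m M^T by rewrite -pM -mulmxA oM mulmx1.
have F0 := homeo_family_puncture (b := infty R) F (@sphere_infty R).
have {}F0 := F0 (fun t t01 => ltac:(by rewrite -pI /L' !mulmxA Lp// pM infty_Rz)).
have K := homeo_family_comp (homeo_family_comp (homeo_family_sym (homeo_family_stereo)) F0)
  homeo_family_stereo.
have Srot := spherical_rotate oM SE lp.1 pM.
have Srot' := spherical_rotate oM' SE' lp'.1 pM'.
apply: rst_step; split; [exact: planar_stereo | exact: planar_stereo | left].
eexists; split.
  split; last by eexists; exact: K.
  move=> w _ /=; rewrite H0; last first.
    by apply: sphere_orthogonal; [exact: orthogonal_tr | exact: unstereo_sphere].
  rewrite /L' L0 mul0r oppr0 Rz0 mul1mx mulmx1.
  by rewrite -mulmxA orthogonal_trK// mulmx1 unstereoK.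
split=> [u u01|u v] /=.
  have Su : @sphere R (curve E u) by exact: (diagram_in SE.1).
  rewrite stereoK.
  - by rewrite mulmx_orthogonalK// L'1 HE.
  - exact: sphere_orthogonal.
  - by case: Srot => _; apply: contra_not => e; exists u => //=; rewrite in_itv.
move=> cuv; apply: Hov.
have off := graph_off Srot.2.
apply/(@crossing_map _ _ _ (mulmxr M)).
  by move=> s t _ _ /(can_inj (mulmx_orthogonalK oM)).
apply/(@crossing_map _ _ _ (@stereo R)); last exact: cuv.
move=> s t s01 t01 e.
rewrite -(stereoK (diagram_in Srot.1 s01) (off s s01)).
by rewrite -(stereoK (diagram_in Srot.1 t01) (off t t01)) [in LHS]e.
Qed.

Lemma carries_id E : carries (fun _ x => x) E E.
Proof. by split. Qed.

(** E and E' agree near the leg, so that a point x near the leg and off the disc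
    of the move lies in the leg region of both.  Projecting both from x turns the
    move into a planar one; changing the point of projection from p to x and from
    x to p' is an instance of [isotopy_planar]. *)
Lemma reidemeister_planar E E' p p' M M' :
  spherical_diagram E -> spherical_diagram E' -> reidemeister (@sphere R) E E' ->
  leg_region E p -> leg_region E' p' ->
  rotation M -> rotation M' -> p *m M = infty R -> p' *m M' = infty R ->
  planar_equiv (stereo_diagram (rotate M E)) (stereo_diagram (rotate M' E')).
Proof.
move=> SE SE' rE lp lp' rM rM' pM pM'.
have [K [cK Kl EK rK]] := reidemeister_avoid rE.
have i0 : 0 <= (0 : R) <= 1 by rewrite lexx ler01.
have ll : leg E' = leg E by have [//|[]] := EK 0 i0.
have nK : nbhs (leg E) (~` K) by apply: open_nbhs_nbhs; split => //; exact: closed_openC.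
have nE := near_leg_region SE; have := near_leg_region SE'; rewrite ll => nE'.
have [x [[Ex [E'x Kx]] Ox]] := sphere_leg_approach SE (filterI nE (filterI nE' nK)).
have Ox' : off_graph E' x.
  case: Ox => Sx Gx; split => // -[u u01 e].
  have u01' : 0 <= u <= 1 by rewrite /= in_itv in u01.
  have [h|[_]] := EK u u01'; last by rewrite e.
  by apply: Gx; exists u => //; rewrite -h.
have lx := Ex Ox; have lx' := E'x Ox'.
have [B rB xB] := rotation_to_infty Ox.1; have oB := rB.1.
have SB := spherical_rotate oB SE Ox xB.
have SB' := spherical_rotate oB SE' Ox' xB.
apply: (rst_trans _ _ _ (stereo_diagram (rotate B E))).
  exact: (isotopy_planar SE SE (isotopy_id _) (carries_id E) lp lx rM rB pM xB).
apply: (rst_trans _ _ _ (stereo_diagram (rotate B E'))); last first.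
  exact: (isotopy_planar SE' SE' (isotopy_id _) (carries_id E') lx' lp' rB rM' xB pM').
apply: rst_step; split; [exact: planar_stereo | exact: planar_stereo | right].
have inA F u : spherical_diagram F -> off_graph F x -> 0 <= u <= 1 ->
    (@sphere R `\ x) (curve F u).
  move=> [KF _] [_ Fx] u01; split; first exact: (diagram_in KF).
  by move=> /= e; apply: Fx; exists u => //=; rewrite in_itv.
have xBI y : (@sphere R `\ x) y -> @sphere R (y *m B) /\ y *m B <> infty R.
  move=> [Sy yx]; split; first exact: sphere_orthogonal.
  by rewrite -xB => /(can_inj (mulmx_orthogonalK oB)).
apply: (@reidemeister_map _ _ _ (@sphere R `\ x) (@plane R)
  (fun y => stereo (y *m B)) _ _ _ E E' _ _ (rK x Kx)) => //.
- move=> y z /xBI[Sy yI] /xBI[Sz zI] e; apply: (can_inj (mulmx_orthogonalK oB)).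
  by rewrite -(stereoK Sy yI) e stereoK.
- move=> y /xBI[Sy yI]; apply: cvg_stereo.
    by rewrite lt_eqF// -subr_gt0 sphere_pz_lt1.
  by apply: cvg_mulmx; [exact: cvg_within | exact: cvg_cst].
- by move=> u u01; exact: inA.
- by move=> u u01; exact: inA.
Qed.

(** The diagrams along a chain of moves need not be normal; each of them is
    projected from some point of its leg region. *)
Lemma spherical_equiv_planar E E' : spherical_equiv E E' ->
  (spherical_diagram E <-> spherical_diagram E') /\
  (spherical_diagram E -> forall p p' M M', leg_region E p -> leg_region E' p' ->
    rotation M -> rotation M' -> p *m M = infty R -> p' *m M' = infty R ->
    planar_equiv (stereo_diagram (rotate M E)) (stereo_diagram (rotate M' E'))).
Proof.
elim=> {E E'} [E E' [SE SE' H]|E|E E' _ [e IH]|E E' E'' _ [e IH] _ [e' IH']].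
- split => // _ p p' M M' lp lp' rM rM' pM pM'.
  case: H => [[h [ih ch _]]|rE|[h [ih ch _]]].
  + exact: (isotopy_planar SE SE' ih ch lp lp').
  + exact: (reidemeister_planar SE SE' rE lp lp').
  + exact: (isotopy_planar SE SE' ih ch lp lp').
- split => // SE p p' M M' lp lp' rM rM' pM pM'.
  exact: (isotopy_planar SE SE (isotopy_id _) (carries_id E) lp lp').
- split; first by rewrite e.
  move=> /e SE p p' M M' lp lp' rM rM' pM pM'.
  by apply: rst_sym; exact: (IH SE p' p).
- split; first by rewrite e.
  move=> SE p p' M M' lp lp' rM rM' pM pM'.
  have SE' := e.1 SE; have [q [N [lq rN qN]]] := leg_region_ex SE'.
  apply: (rst_trans _ _ _ (stereo_diagram (rotate N E'))).
    exact: (IH SE p q).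
  exact: (IH' SE' q p').
Qed.

Lemma rotate1 E : rotate 1%:M E = E.
Proof.
case: E => c o; rewrite /rotate /map_diagram /=; congr Diagram.
by apply/funext => u /=; rewrite mulmx1.
Qed.

Lemma normal_equiv_planar E E' : spherical_diagram E -> normal E ->
  spherical_diagram E' -> normal E' -> spherical_equiv E E' ->
  planar_equiv (stereo_diagram E) (stereo_diagram E').
Proof.
move=> SE nE SE' nE' /spherical_equiv_planar[_ /(_ SE)].
move=> /(_ (infty R) (infty R) 1%:M 1%:M); rewrite !mulmx1 !rotate1; apply => //.
- exact/normalP.
- exact/normalP.
- exact: rotation1.
- exact: rotation1.
Qed.

(** Rotating the sphere until a point of the leg region is at the north pole. *)
Lemma normal_ex E : spherical_diagram E -> exists E',
  [/\ spherical_diagram E', normal E' & spherical_equiv E E'].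
Proof.
move=> SE; have [p [_ [lp _ _]]] := leg_region_ex SE.
have [m Sm pm] := halfturn_to_infty lp.1.1.
have om := orthogonal_halfturn (sphere_neq0 Sm).
have SE' := spherical_rotate om SE lp.1 pm.
exists (rotate (halfturn m) E); split => //.
  by apply/normalP => //; rewrite -pm; exact: rotate_region.
have [L [Lc Lo L0 L1]] := halfturn_path Sm.
have iL := isotopy_rotation Lc Lo L0.
have cL : carries (fun t x => x *m L t) E (rotate (halfturn m) E).
  by split => // u u01; rewrite L1.
apply: rst_step; split => //.
have [h|h] := pselect (exists t u, [/\ 0 <= t <= 1, 0 <= u <= 1 & curve E u *m L t = infty R]).
  by apply: Or33; exists (fun t x => x *m L t).
apply: Or31; exists (fun t x => x *m L t); split => // t u t01 u01 e.
by apply: h; exists t, u.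
Qed.

End Planarize.

(** * From the plane to the sphere, and the two notions of state *)

Section Lifting.
Context {R : realType}.
Implicit Types (E : diagram 'rV[R]_3) (D : diagram 'rV[R]_2).

Definition lift_diagram D := map_diagram unstereo D.

Lemma lift_diagramK D : stereo_diagram (lift_diagram D) = D.
Proof.
case: D => c o; rewrite /stereo_diagram /=; congr Diagram.
by apply/funext => u /=; rewrite unstereoK.
Qed.

Lemma lift_step D D' : planar_move D D' ->
  spherical_step (lift_diagram D) (lift_diagram D').
Proof.
move=> [PD PD' H]; split; [exact: spherical_unstereo | exact: spherical_unstereo |].
case: H => [[h [[h0 [g fh]] [hc hov]]]|r].
  apply: Or31; exists (extend_infty h); split.
  - split.
      move=> x Sx; have [->|xI] := pselect (x = infty R).
        by rewrite /extend_infty eqxx.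
      by rewrite extend_inftyE// h0// stereoK.
    by exists (extend_infty g); exact: homeo_family_extend.
  - split=> [u u01|u v] /=.
      by rewrite extend_inftyE ?unstereoK ?hc//; exact: unstereo_neq.
    move=> /(@crossing_map _ _ _ (@unstereo R)) cuv; apply: hov; apply: cuv.
    by move=> s t _ _ /(can_inj unstereoK).
  - move=> t u t01 u01; rewrite extend_inftyE; last exact: unstereo_neq.
    exact: unstereo_neq.
apply: Or32; apply: (reidemeister_map (A := @plane R)) r => //.
- by move=> x _; exact: unstereo_sphere.
- by move=> x y _ _ /(can_inj unstereoK).
- move=> x _; apply: cvg_unstereo; exact: cvg_within.
Qed.

Lemma lift_equiv D D' : planar_equiv D D' ->
  spherical_equiv (lift_diagram D) (lift_diagram D').
Proof.
elim=> {D D'} [D D' /lift_step|D|D D' _|D D' D'' _ + _].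
- exact: rst_step.
- exact: rst_refl.
- exact: rst_sym.
- exact: rst_trans.
Qed.

Lemma lift_stereo E : spherical_diagram E ->
  spherical_equiv E (lift_diagram (stereo_diagram E)).
Proof.
move=> SE; have PD := planar_stereo SE; have off := graph_off SE.2.
apply: rst_step; split => //; first exact: spherical_unstereo.
apply: Or31; exists (fun _ x => x); split; first exact: isotopy_id.
  split => // u u01 /=; rewrite stereoK//; first exact: (diagram_in SE.1).
  exact: off.
by move=> t u _ u01; exact: off.
Qed.

Lemma unbounded_sqnorm (A : set 'rV[R]_2) (M : R) : ~ bounded_set A ->
  exists2 w, A w & M < sqnorm w.
Proof.
move=> nb; apply: contrapT => h; apply: nb.
have [N [Nr hN]] := compact_bounded (@compact_sqnorm_le R 2 M).
exists N; split => // K NK x Ax; apply: hN => //=.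
by rewrite leNgt; apply/negP => Mx; apply: h; exists x.
Qed.

Lemma bounded_sqnorm_le (A : set 'rV[R]_2) : bounded_set A ->
  exists M : R, forall w, A w -> sqnorm w <= M.
Proof.
move=> [N [Nr hN]]; pose K := Num.max 1 (N + 1).
have K1 : 1 <= K by rewrite le_max lexx.
have NK : N < K by rewrite lt_max; apply/orP; right; rewrite ltrDl.
exists (K ^+ 2 + K ^+ 2) => w Aw; have /= := hN K NK w Aw.
rewrite [`|w|]mx_normrE => h; rewrite sqnorm2.
have e (j : 'I_2) : w ord0 j ^+ 2 <= K ^+ 2.
  rewrite -(real_normK (num_real (w ord0 j))) ler_pXn2r ?nnegrE//; last by lra.
  apply: le_trans h.
  exact: (le_bigmax _ (fun ij : 'I_1 * 'I_2 => `|w ij.1 ij.2|) (ord0, j)).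
by apply: lerD; exact: e.
Qed.

(** The north pole is a limit of the lift of the unbounded region. *)
Lemma state_normal D : planar_diagram D -> in_spherical_state D ->
  normal (lift_diagram D).
Proof.
move=> PD [x [Ox nb cl]]; set C := connected_component _ x in nb cl.
have SE := spherical_unstereo PD.
have OE w : (@plane R `\` graph D) w -> off_graph (lift_diagram D) (unstereo w).
  by move=> [_ Gw]; split; [exact: unstereo_sphere | move=> /graph_unstereo].
have cC : connected (unstereo @` C).
  apply: connected_continuous_connected; first exact: component_connected.
  by apply: continuous_subspaceT; exact: continuous_unstereo.
have Ci : closure (unstereo @` C) (infty R).
  move=> W /nbhs_ballP[e /= e0 hW].
  have [M hM] := unstereo_near_infty e0.
  have [w Cw Mw] := unbounded_sqnorm M nb.
  exists (unstereo w); split; first by exists w.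
  by apply: hW; rewrite -ball_normE /= distrC; exact: hM.
have cCi := connected_add_limit cC Ci.
have sub : unstereo @` C `<=` connected_component (off_graph (lift_diagram D)) (infty R).
  move=> y Cy; exists (unstereo @` C `|` [set infty R]) => //; last by left.
  split => //; first by right.
  move=> z [[w Cw <-]|->]; first by apply: OE; exact: connected_component_sub Cw.
  by split; [exact: sphere_infty | exact: SE.2].
apply: (closureS sub).
have cu : {within setT, continuous (@unstereo R)}.
  by apply: continuous_subspaceT; exact: continuous_unstereo.
have im w : C w -> (unstereo @` C) (unstereo w) by exists w.
exact: (@closure_image _ _ setT C _ unstereo (leg D) I (fun _ _ => I) cu im cl).
Qed.

Lemma component_near D w : planar_diagram D -> (@plane R `\` graph D) w ->
  \forall v \near w, connected_component (@plane R `\` graph D) w v.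
Proof.
move=> PD [_ Gw].
have nG : nbhs w (~` graph D).
  by apply: open_nbhs_nbhs; split => //; apply: closed_openC; exact: graph_closed PD.
case/nbhs_ballP : nG => e /= e0 he.
apply/nbhs_ballP; exists e => //= v wv.
apply: segment_component => t /andP[t0 t1]; split => //; apply: he.
move: wv; rewrite -!ball_normE /= => wv.
rewrite opprD addrA subrr add0r normrN normrZ ger0_norm//.
rewrite distrC in wv; apply: le_lt_trans wv.
by rewrite ler_piMl.
Qed.

(** Let z be a point of the planar region at the leg.  If this region were
    bounded, its lift would be open and closed in the complement of the graph on
    the sphere and would contain the whole region of the north pole, which touches
    the leg as well; but it does not contain the north pole. *)
Lemma normal_state E : spherical_diagram E -> normal E ->
  in_spherical_state (stereo_diagram E).
Proof.
move=> SE nE; have [Sl lI] := leg_sphere SE; have PD := planar_stereo SE.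
set D := stereo_diagram E in PD *.
set A := @plane R `\` graph D.
have [N [z [nN Nz]]] := leg_connected PD.
have [x0 [Nx0 Ox0]] := leg_approach PD nN.
have Az : A z by exact: connected_component_sub (connected_component_sym (Nz _ Nx0 Ox0.2)).
exists z; split => //; last first.
  move=> W nW; have [x [[Nx Wx] [_ Gx]]] := leg_approach PD (filterI nN nW).
  by exists x; split => //; exact: Nz.
move=> /bounded_sqnorm_le[M hM].
set C := connected_component (off_graph E) (infty R).
have Oi : off_graph E (infty R) by split; [exact: sphere_infty | exact: SE.2].
have cC : connected C by exact: component_connected.
pose P y := y <> infty R /\ connected_component A z (stereo y).
have [y [Cy [yI Ny]]] := nE _ (near_stereo Sl lI nN).
have CO x : C x -> off_graph E x := @connected_component_sub _ _ _ x.
have As x : C x -> x <> infty R -> A (stereo x).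
  move=> /CO[Sx Gx] xI; split => //; by move=> /(graph_stereo SE Sx xI).
have Py : P y by split => //; apply: Nz => //; have [] := As y Cy yI.
have [] := connected_locally_constant (P := P) cC Cy Py _ _
  (connected_component_refl Oi) => //.
- move=> x Cx [xI zx]; have [Sx Gx] := CO _ Cx.
  have := near_stereo Sx xI (component_near PD (As x Cx xI)).
  apply: filterS => v [vI cv] _; split => //.
  exact: connected_component_trans cv.
- move=> x Cx nP; have [Sx Gx] := CO _ Cx.
  have [e|xI] := pselect (x = infty R).
    rewrite e; apply: filterS (near_infty_stereo M) => q qM Cq [qI zq].
    by have := hM _ zq; rewrite leNgt qM//; exact: (CO _ Cq).1.
  have := near_stereo Sx xI (component_near PD (As x Cx xI)).
  apply: filterS => v [vI cv] Cv [_ zv]; apply: nP; split => //.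
  exact: connected_component_trans zv (connected_component_sym cv).
Qed.

End Lifting.

(** * The bijection *)

Theorem theorem2p1 (R : realType) :
  exists f : set (diagram 'rV[R]_3) -> set (diagram 'rV[R]_2),
    set_bij (@spherical_knotoids R) (@knotoids_in_spherical_state R) f /\
    (forall E : diagram 'rV[R]_3, spherical_diagram E -> normal E ->
       f (spherical_class E) = planar_class (stereo_diagram E)).
Proof.
(* Defined without choosing a normal representative: all of them contribute the
   same planar class. *)
pose f (c : set (diagram 'rV[R]_3)) := [set D | exists E,
  [/\ spherical_diagram E, normal E, c E & planar_equiv (stereo_diagram E) D]].
have fE E : spherical_diagram E -> normal E ->
    f (spherical_class E) = planar_class (stereo_diagram E).
  move=> SE nE; rewrite eqEsubset; split => D.
    move=> [E' [SE' nE' EE' E'D]]; apply: rst_trans E'D.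
    exact: normal_equiv_planar.
  by move=> ED; exists E; split => //; exact: rst_refl.
have sclassE (E E' : diagram 'rV[R]_3) : spherical_equiv E E' ->
    spherical_class E = spherical_class E'.
  move=> EE'; rewrite eqEsubset; split => F /=; apply: rst_trans => //.
  exact: rst_sym.
have pclassE (D D' : diagram 'rV[R]_2) : planar_equiv D D' ->
    planar_class D = planar_class D'.
  move=> DD'; rewrite eqEsubset; split => F /=; apply: rst_trans => //.
  exact: rst_sym.
have nclass c : @spherical_knotoids R c -> exists E,
    [/\ spherical_diagram E, normal E & c = spherical_class E].
  move=> [E SE <-]; have [E' [SE' nE' EE']] := normal_ex SE.
  by exists E'; split => //; exact: sclassE.
exists f; split => //; split.
- move=> c /nclass[E [SE nE ->]]; rewrite fE//; split.
    by exists (stereo_diagram E) => //; exact: planar_stereo.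
  exists (stereo_diagram E); split; [exact: planar_stereo | exact: rst_refl |].
  exact: normal_state.
- move=> c c'; rewrite !inE => /nclass[E [SE nE ->]] /nclass[E' [SE' nE' ->]].
  rewrite !fE// => e; apply: sclassE.
  have EE' : planar_equiv (stereo_diagram E) (stereo_diagram E').
    have : planar_class (stereo_diagram E') (stereo_diagram E') by exact: rst_refl.
    by rewrite -e.
  apply: rst_trans (lift_stereo SE) _.
  by apply: rst_trans (lift_equiv EE') _; apply: rst_sym; exact: lift_stereo.
- move=> k [[D0 PD0 <-] [D [PD D0D sD]]].
  exists (spherical_class (lift_diagram D)).
    by exists (lift_diagram D) => //; exact: spherical_unstereo.
  rewrite fE; [|exact: spherical_unstereo|exact: state_normal].
  by rewrite lift_diagramK; apply/esym/pclassE.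
Qed.
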